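(* Let $\mathfrak g$ be a stratified Lie algebra of step at most $3$. Then $\mathfrak g$ is not semigenerated if and only if $\mathfrak g$ has one of the Engel-type algebras $\mathbb{En}^n$, $n\ge 1$, as a quotient.
   Context: All Lie algebras are finite-dimensional and real. A stratified Lie algebra (Carnot algebra) of step $s\ge 1$ is a Lie algebra with a decomposition $\mathfrak g=V_1\oplus\cdots\oplus V_s$ such that $[V_1,V_j]=V_{j+1}$ for $1\le j<s$, $[V_1,V_s]=\{0\}$ and $V_s\neq\{0\}$. Its rank is $\dim V_1$. Let $G$ be the simply connected Lie group with Lie algebra $\mathfrak g$; the exponential map $\exp:\mathfrak g\to G$ is a diffeomorphism. A horizontal half-space of $\mathfrak g$ is a set $W=\lambda^{-1}([0,+\infty))\subseteq V_1$ with $\lambda$ a non-zero element of the dual of $V_1$. A set $W\subseteq\mathfrak g$ is semigenerating if the closure of the semigroup generated by $\exp(W)$ in $G$ (the set of all finite products of elements of $\exp(W)$) contains the commutator subgroup $[G,G]=\exp([\mathfrak g,\mathfrak g])$. The Lie algebra $\mathfrak g$ is semigenerated if every horizontal half-space in $\mathfrak g$ is semigenerating. For each integer $n\ge1$, the $n$-th Engel-type algebra $\mathbb{En}^n$ is the $2(n+1)$-dimensional Lie algebra (of step 3 and rank $n+1$) with basis $\{X,Y_i,T_i,Z\}_{i=1}^n$ whose only non-trivial brackets are $[Y_i,X]=T_i$ and $[Y_i,T_i]=Z$ for all $i\in\{1,\dots,n\}$. ''$\mathfrak g$ has $\mathbb{En}^n$ as a quotient'' means that there is a homogeneous ideal $\mathfrak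 i$ of $\mathfrak g$ (i.e. $\mathfrak i=\bigoplus_i(\mathfrak i\cap V_i)$) with $\mathfrak g/\mathfrak i$ isomorphic to $\mathbb{En}^n$. *)

(* Defs.v *)
From HB Require Import structures.
From mathcomp Require Import all_boot all_order all_algebra.
From mathcomp Require Import ring.
From mathcomp Require Import all_classical all_reals all_analysis.
Set Implicit Arguments.
Unset Strict Implicit.
Unset Printing Implicit Defensive.
Import Order.TTheory GRing.Theory Num.Theory.
Import numFieldNormedType.Exports.
Local Open Scope classical_set_scope.
Local Open Scope ring_scope.
Local Open Scope quotient_scope.

HB.mixin Record Lmodule_isLie (R : comNzRingType) V of GRing.Lmodule R V := {
  lie : V -> V -> V;
  lie_linearl : forall z a x y, lie (a *: x + y) z = a *: lie x z + lie y z;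
  lie_linearr : forall z a x y, lie z (a *: x + y) = a *: lie z x + lie z y;
  liexx : forall x, lie x x = 0;
  lie_jacobi : forall x y z,
    lie x (lie y z) + lie y (lie z x) + lie z (lie x y) = 0
}.

#[short(type="lieAlgType")]
HB.structure Definition LieAlgebra (R : comNzRingType) :=
  {V of GRing.Lmodule R V & Lmodule_isLie R V}.

#[short(type="vectLieAlgType")]
HB.structure Definition VectLieAlgebra (R : comNzRingType) :=
  {V of LieAlgebra R V & Vector R V}.

Definition lie_isomorphic (R : comNzRingType) (L M : lieAlgType R) : Prop :=
  exists2 f : {linear L -> M},
    bijective f & forall x y, f (lie x y) = lie (f x) (f y).

Section LieTheory.
Context {R : comNzRingType} {L : lieAlgType R}.
Implicit Types x y z : L.

Lemma lieDl x y z : lie (x + y) z = lie x z + lie y z.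
Proof. by have := lie_linearl z 1 x y; rewrite !scale1r. Qed.

Lemma lieDr x y z : lie z (x + y) = lie z x + lie z y.
Proof. by have := lie_linearr z 1 x y; rewrite !scale1r. Qed.

Lemma lieBr x y z : lie z (x - y) = lie z x - lie z y.
Proof. by rewrite addrC -scaleN1r lie_linearr scaleN1r addrC. Qed.

Lemma lieC x y : lie x y = - lie y x.
Proof.
apply/eqP; rewrite -addr_eq0; have := liexx (x + y).
by rewrite lieDl !lieDr !liexx add0r addr0 => ->.
Qed.

End LieTheory.

Section Stratification.
Context {K : fieldType} {g : vectLieAlgType K}.
Implicit Types (U W I : {vspace g}) (V : nat -> {vspace g}).

(* [U, W] is the linear span of the brackets; by bilinearity it is enough to
   bracket basis vectors (same encoding as the product of subspaces prodv). *)
Definition liev U W : {vspace g} :=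
  <<[seq lie u w | u <- vbasis U, w <- vbasis W]>>%VS.

(* The layers are V 1, ..., V s; the values of V outside of this range play no
   role. *)
Record stratification (s : nat) V : Prop := Stratification {
  strat_step_gt0 : (0 < s)%N;
  strat_direct : directv (\sum_(i < s) V i.+1);
  strat_full : (\sum_(i < s) V i.+1)%VS = fullv;
  strat_lie : forall j, (1 <= j < s)%N -> liev (V 1%N) (V j) = V j.+1;
  strat_lie_last : liev (V 1%N) (V s) = 0%VS;
  strat_last_neq0 : V s != 0%VS
}.

Definition homogeneous (s : nat) V I : Prop :=
  I = (\sum_(i < s) (I :&: V i.+1))%VS.

End Stratification.

Record lieIdeal (K : fieldType) (g : vectLieAlgType K) := LieIdeal {
  ideal_vspace :> {vspace g};
  memv_lie : forall x y, y \in ideal_vspace -> lie x y \in ideal_vspace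
}.

Section LieQuotient.
Context {K : fieldType} {g : vectLieAlgType K} (I : lieIdeal g).

(* The library provides the additive group structure of the quotient; the
   scaling and the bracket are those of representatives. *)
Definition lie_quot := Quotient.quot (ideal_vspace I).

HB.instance Definition _ := GRing.Zmodule.on lie_quot.

Definition quot_scale (a : K) (p : lie_quot) : lie_quot :=
  \pi_lie_quot (a *: repr p).
Definition quot_lie (p q : lie_quot) : lie_quot :=
  \pi_lie_quot (lie (repr p) (repr q)).

Local Notation piq := (\pi_lie_quot).

Lemma quot_ind (P : lie_quot -> Prop) :
  (forall x, P (piq x)) -> forall p, P p.
Proof. by move=> Ppi p; rewrite -[p]reprK; apply: Ppi. Qed.

Lemma quot_eq (x y : g) :
  (piq x == piq y :> lie_quot) = (x - y \in ideal_vspace I).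
Proof. by rewrite Quotient.idealrBE. Qed.

Lemma quotD (x y : g) : piq (x + y) = piq x + piq y :> lie_quot.
Proof. exact: (raddfD piq). Qed.

Lemma quot0 : piq 0 = 0 :> lie_quot.
Proof. exact: (raddf0 piq). Qed.

Lemma quot_reprB (x : g) : repr (piq x) - x \in ideal_vspace I.
Proof. by rewrite -quot_eq reprK. Qed.

Lemma quot_scaleE (a : K) (x : g) : quot_scale a (piq x) = piq (a *: x).
Proof. by apply/eqP; rewrite quot_eq -scalerBr memvZ// quot_reprB. Qed.

Lemma quot_lieE (x y : g) : quot_lie (piq x) (piq y) = piq (lie x y).
Proof.
apply/eqP; rewrite quot_eq; set x' := repr _; set y' := repr _.
have -> : lie x' y' - lie x y = lie x' (y' - y) - lie y (x' - x).
  rewrite !lieBr [lie y x']lieC [lie y x]lieC opprD !opprK.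
  by rewrite addrA subrK.
by rewrite rpredB// memv_lie// quot_reprB.
Qed.

Fact quot_scaleA a b p : quot_scale a (quot_scale b p) = quot_scale (a * b) p.
Proof. by elim/quot_ind: p => x; rewrite !quot_scaleE scalerA. Qed.

Fact quot_scale1 : left_id 1 quot_scale.
Proof. by elim/quot_ind => x; rewrite quot_scaleE scale1r. Qed.

Fact quot_scaleDr : right_distributive quot_scale +%R.
Proof.
move=> a; elim/quot_ind => x; elim/quot_ind => y.
by rewrite -quotD !quot_scaleE scalerDr quotD.
Qed.

Fact quot_scaleDl p : {morph quot_scale^~ p : a b / a + b}.
Proof.
by elim/quot_ind: p => x a b; rewrite !quot_scaleE scalerDl quotD.
Qed.

HB.instance Definition _ := GRing.Zmodule_isLmodule.Build K lie_quot
  quot_scaleA quot_scale1 quot_scaleDr quot_scaleDl.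

Fact quot_linearl (r : lie_quot) (a : K) (p q : lie_quot) :
  quot_lie (a *: p + q) r = a *: quot_lie p r + quot_lie q r.
Proof.
elim/quot_ind: r => z; elim/quot_ind: p => x; elim/quot_ind: q => y.
rewrite !/(_ *: _)/= quot_scaleE -quotD !quot_lieE quot_scaleE -quotD.
by rewrite lie_linearl.
Qed.

Fact quot_linearr (r : lie_quot) (a : K) (p q : lie_quot) :
  quot_lie r (a *: p + q) = a *: quot_lie r p + quot_lie r q.
Proof.
elim/quot_ind: r => z; elim/quot_ind: p => x; elim/quot_ind: q => y.
rewrite !/(_ *: _)/= quot_scaleE -quotD !quot_lieE quot_scaleE -quotD.
by rewrite lie_linearr.
Qed.

Fact quot_liexx p : quot_lie p p = 0.
Proof. by elim/quot_ind: p => x; rewrite quot_lieE liexx quot0. Qed.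

Fact quot_jacobi p q r :
  quot_lie p (quot_lie q r) + quot_lie q (quot_lie r p)
    + quot_lie r (quot_lie p q) = 0.
Proof.
elim/quot_ind: r => z; elim/quot_ind: p => x; elim/quot_ind: q => y.
by rewrite !quot_lieE -!quotD lie_jacobi quot0.
Qed.

HB.instance Definition _ := Lmodule_isLie.Build K lie_quot
  quot_linearl quot_linearr quot_liexx quot_jacobi.

End LieQuotient.

(* (a, y, t, b) stands for a X + \sum_i y_i Y_i + \sum_i t_i T_i + b Z; the
   formula for the bracket is the bilinear alternating extension of
   [Y_i, X] = T_i, [Y_i, T_i] = Z. *)
Definition engel (R : comNzRingType) (n : nat) : Type :=
  (R^o * 'rV[R]_n * 'rV[R]_n * R^o)%type.

Section Engel.
Context {R : comNzRingType} {n : nat}.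
Implicit Types u v w : engel R n.

HB.instance Definition _ := GRing.Lmodule.on (engel R n).
HB.instance Definition _ := Vector.on (engel R n).

Definition engel_lie u v : engel R n :=
  let: (a, y, t, _) := u in let: (a', y', t', _) := v in
  (0, 0, a' *: y - a *: y', \sum_i (y 0 i * t' 0 i - t 0 i * y' 0 i)).

Fact engel_linearl w (c : R) u v :
  engel_lie (c *: u + v) w = c *: engel_lie u w + engel_lie v w.
Proof.
move: u v w => [[[a1 y1] t1] b1] [[[a2 y2] t2] b2] [[[a3 y3] t3] b3] /=.
congr (_, _, _, _).
- by rewrite /= scaler0 addr0.
- by rewrite /= scaler0 addr0.
- by apply/rowP => i; rewrite /= /GRing.scale/= !mxE; ring.
- rewrite /= /GRing.scale/= mulr_sumr -big_split/=; apply: eq_bigr => i _.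
  by rewrite !mxE; ring.
Qed.

Fact engel_linearr w (c : R) u v :
  engel_lie w (c *: u + v) = c *: engel_lie w u + engel_lie w v.
Proof.
move: u v w => [[[a1 y1] t1] b1] [[[a2 y2] t2] b2] [[[a3 y3] t3] b3] /=.
congr (_, _, _, _).
- by rewrite /= scaler0 addr0.
- by rewrite /= scaler0 addr0.
- by apply/rowP => i; rewrite /= /GRing.scale/= !mxE; ring.
- rewrite /= /GRing.scale/= mulr_sumr -big_split/=; apply: eq_bigr => i _.
  by rewrite !mxE; ring.
Qed.

Fact engel_liexx u : engel_lie u u = 0.
Proof.
move: u => [[[a y] t] b] /=; congr (_, _, _, _); first by rewrite subrr.
by apply: big1 => i _; rewrite mulrC subrr.
Qed.

Fact engel_jacobi u v w :
  engel_lie u (engel_lie v w) + engel_lie v (engel_lie w u)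
    + engel_lie w (engel_lie u v) = 0.
Proof.
move: u v w => [[[a1 y1] t1] b1] [[[a2 y2] t2] b2] [[[a3 y3] t3] b3] /=.
congr (_, _, _, _) => /=.
- by rewrite !addr0.
- by rewrite !addr0.
- by rewrite !scaler0 !scale0r !subrr !addr0.
- rewrite -!big_split/=; apply: big1 => i _; rewrite !mxE; ring.
Qed.

HB.instance Definition _ := Lmodule_isLie.Build R (engel R n)
  engel_linearl engel_linearr engel_liexx engel_jacobi.

Definition engelX : engel R n := (1, 0, 0, 0).
Definition engelY i : engel R n := (0, delta_mx 0 i, 0, 0).
Definition engelT i : engel R n := (0, 0, delta_mx 0 i, 0).
Definition engelZ : engel R n := (0, 0, 0, 1).

Lemma engel_lieYX i : lie (engelY i) engelX = engelT i.
Proof.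
rewrite /lie/=; congr (_, _, _, _); first by rewrite scale1r scale0r subr0.
by apply: big1 => j _; rewrite !mxE mulr0 mul0r subrr.
Qed.

Lemma engel_lieYT i j : lie (engelY i) (engelT j) = if i == j then engelZ else 0.
Proof.
rewrite /lie/= !scale0r subr0; have [<-|neq_ij] := eqVneq i j;
  congr (_, _, _, _).
  rewrite (bigD1 i)//= big1 ?addr0; first by rewrite !mxE !eqxx mulr1 mulr0 subr0.
  by move=> k /negPf ki; rewrite !mxE ki andbF !mul0r subrr.
apply: big1 => k _; rewrite !mxE !eqxx /= mulr0 subr0.
have [->|_] := eqVneq k i; first by rewrite (negPf neq_ij) mulr0.
by rewrite mul0r.
Qed.

Lemma engel_lieYY i j : lie (engelY i) (engelY j) = 0.
Proof.
rewrite /lie/= !scale0r subrr; congr (_, _, _, _).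
by apply: big1 => k _; rewrite !mxE mulr0 mul0r subrr.
Qed.

Lemma engel_lieTT i j : lie (engelT i) (engelT j) = 0.
Proof.
rewrite /lie/= !scale0r subrr; congr (_, _, _, _).
by apply: big1 => k _; rewrite !mxE mulr0 mul0r subrr.
Qed.

Lemma engel_lieXT i : lie engelX (engelT i) = 0.
Proof.
rewrite /lie/= scale0r scaler0 subrr; congr (_, _, _, _).
by apply: big1 => k _; rewrite !mxE mulr0 mul0r subrr.
Qed.

Lemma engel_lieZ u : lie engelZ u = 0.
Proof.
case: u => [[[a y] t] b]; rewrite /lie/= scale0r scaler0 subrr.
by congr (_, _, _, _); apply: big1 => k _; rewrite !mxE !mul0r subrr.
Qed.

End Engel.

Section Semigeneration.
Context {R : realType} {g : vectLieAlgType R}.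
Implicit Types (x y : g) (A W : set g) (U : {vspace g}).

(* The simply connected group G of a nilpotent Lie algebra g is modelled in
   exponential coordinates: exp : g -> G being a diffeomorphism, G is identified
   with g, exp with the identity, the inversion with x |-> - x, the unit with 0,
   and the product with the Baker-Campbell-Hausdorff series
   log (exp x exp y). In step at most 3, the brackets of four or more elements
   vanish, so that the series is exactly the following sum; for Lie algebras of
   higher step bch3 is only a truncation. *)
Definition bch3 x y : g :=
  x + y + 2^-1 *: lie x y
  + 12^-1 *: (lie x (lie x y) + lie y (lie y x)).

Inductive semigroup_gen A : g -> Prop :=
| semigroup_gen_in x : A x -> semigroup_gen A x
| semigroup_gen_mul x y :
    semigroup_gen A x -> semigroup_gen A y -> semigroup_gen A (bch3 x y).

Inductive commutator_subgroup : g -> Prop :=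
| commutator_in x y :
    commutator_subgroup (bch3 (bch3 x y) (bch3 (- x) (- y)))
| commutator_1 : commutator_subgroup 0
| commutator_mul x y : commutator_subgroup x -> commutator_subgroup y ->
    commutator_subgroup (bch3 x y)
| commutator_inv x : commutator_subgroup x -> commutator_subgroup (- x).

(* The topology of the finite-dimensional space g is read in the coordinates
   relative to a basis; all bases give the same topology. *)
Definition lie_closure A : set g :=
  [set x | closure (passmx.rVof (vbasis {:g}) @` A)
                   (passmx.rVof (vbasis {:g}) x)].

Definition semigenerating W : Prop :=
  commutator_subgroup `<=` lie_closure (semigroup_gen W).

Definition horizontal_half_space U W : Prop :=
  exists2 l : 'Hom(subvs_of U, R^o),
    l != 0 & W = [set vsval u | u in [set u | 0 <= l u]].

Definition semigenerated U : Prop :=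
  forall W, horizontal_half_space U W -> semigenerating W.

End Semigeneration.

Definition has_engel_quotient (K : fieldType) (g : vectLieAlgType K)
    (s : nat) (V : nat -> {vspace g}) (n : nat) : Prop :=
  exists2 I : lieIdeal g,
    homogeneous s V I & lie_isomorphic (lie_quot I) (engel K n).

(* Main.v *)
(* Let [S] be the closed semigroup generated by a half-space with edge [U] and
   inner normal [X], and call [x] invertible if [x] and [- x] lie in [S].
   Commutators, conjugation by invertible elements and dilations show that the
   brackets of elements of [U] and [[X, [U, U]]] are invertible, that every
   [[u, [u, X]]] lies in [S], and that if it is invertible, so are [[u, X]] and
   [[X, [u, X]]]. If all of them are invertible, then [S] contains [V2 + V3].
   Otherwise choose a linear form [mu], nonnegative on the closed convex cone
   [S `&` V3], whose zeros in the cone are invertible. The form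
   [mu [u, [w, X]]] is then symmetric, positive semidefinite and nonzero on [U],
   and [mu [X, [u, X]]] vanishes on its radical; so [X] can be corrected by an
   element of [U] that makes the latter vanish identically, and an orthonormal
   family for the form spans, with [X], an Engel-type quotient.

   Conversely, in an Engel-type group the semigroup generated by the half-space
   where the [X]-coordinate is nonnegative consists of elements at which the
   integral of [|y|^2 dx] is nonnegative, which excludes [exp (- Z)]. *)

Require Import Defs.
From HB Require Import structures.
From mathcomp Require Import all_boot all_order all_algebra.
From mathcomp Require Import ring lra.
From mathcomp Require Import all_classical all_reals all_analysis.

Set Implicit Arguments.
Unset Strict Implicit.
Unset Printing Implicit Defensive.
Import Order.TTheory GRing.Theory Num.Theory.
Import numFieldNormedType.Exports passmx.
Local Open Scope classical_set_scope.
Local Open Scope ring_scope.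

(** * Brackets and the Baker-Campbell-Hausdorff product in step 3 *)

Section LieLemmas.
Context {K : comNzRingType} {L : lieAlgType K}.
Implicit Types (x y z : L) (a : K).

Lemma lie0l z : lie 0 z = 0 :> L.
Proof. by apply: (@addrI _ (lie 0 z)); rewrite -lieDl !addr0. Qed.

Lemma lie0r z : lie z 0 = 0 :> L.
Proof. by rewrite lieC lie0l oppr0. Qed.

Lemma lieZl a x z : lie (a *: x) z = a *: lie x z.
Proof. by rewrite -[a *: x]addr0 lie_linearl lie0l addr0. Qed.

Lemma lieZr a x z : lie z (a *: x) = a *: lie z x.
Proof. by rewrite lieC lieZl -scalerN -lieC. Qed.

Lemma lieNl x z : lie (- x) z = - lie x z.
Proof. by rewrite -scaleN1r lieZl scaleN1r. Qed.

Lemma lieNr x z : lie z (- x) = - lie z x.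
Proof. by rewrite -scaleN1r lieZr scaleN1r. Qed.

Lemma lie_suml I (r : seq I) (P : pred I) (F : I -> L) z :
  lie (\sum_(i <- r | P i) F i) z = \sum_(i <- r | P i) lie (F i) z.
Proof.
by apply: (big_morph (lie^~ z)) => [x y|]; [exact: lieDl|exact: lie0l].
Qed.

Lemma lie_sumr I (r : seq I) (P : pred I) (F : I -> L) z :
  lie z (\sum_(i <- r | P i) F i) = \sum_(i <- r | P i) lie z (F i).
Proof.
by apply: (big_morph (lie z)) => [x y|]; [exact: lieDr|exact: lie0r].
Qed.

Lemma lie_lie x y z : lie (lie x y) z = lie x (lie y z) - lie y (lie x z).
Proof.
have := lie_jacobi x y z; rewrite [lie z x]lieC [lie z (lie x y)]lieC lieNr.
by move/eqP; rewrite subr_eq0 => /eqP ->.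
Qed.

End LieLemmas.

Section Coordinates.
Context {R : fieldType} {g : vectType R}.
Implicit Types (x y : g).

Definition co (i : 'I_(\dim {:g})) x : R := coord (vbasis {:g}) i x.

Lemma coD i x y : co i (x + y) = co i x + co i y.
Proof. exact: linearD. Qed.

Lemma coN i x : co i (- x) = - co i x.
Proof. exact: linearN. Qed.

Lemma coZ i a x : co i (a *: x) = a * co i x.
Proof. exact: linearZ. Qed.

Lemma co0 i : co i 0 = 0.
Proof. exact: linear0. Qed.

Lemma co_inj x y : (forall i, co i x = co i y) -> x = y.
Proof.
move=> eq_co; rewrite (coord_vbasis (memvf x)) (coord_vbasis (memvf y)).
by apply: eq_bigr => i _; congr (_ *: _); exact: eq_co.
Qed.

End Coordinates.

(* Linear identities are checked coordinatewise, where [ring] applies. *)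
Ltac vring := apply: co_inj => ?; rewrite ?(coD, coN, coZ, co0); ring.
Ltac vfield := apply: co_inj => ?; rewrite ?(coD, coN, coZ, co0); field.

Section Bch.
Context {R : realType} {g : vectLieAlgType R}.
Implicit Types (x y z v : g).

Lemma bch3N x y : bch3 (- y) (- x) = - bch3 x y.
Proof. by rewrite /bch3 !(lieNl, lieNr) [lie y x]lieC !lieNr; vring. Qed.

Hypothesis lie4 : forall x y z v : g, lie x (lie y (lie z v)) = 0.

(* The general element of the Lie subalgebra generated by [x] and [y] *)
Let comb x y (a b c d e : R) : g :=
  a *: x + b *: y + c *: lie x y + d *: lie x (lie x y) + e *: lie y (lie x y).

(** By [lie4] the triple brackets are central, so five coefficients describe every product of such
    elements, and identities for [bch3] become polynomial identities in the coefficients. *)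
Let lie_comb x y a b c d e a' b' c' d' e' :
  lie (comb x y a b c d e) (comb x y a' b' c' d' e') =
  comb x y 0 0 (a * b' - b * a') (a * c' - c * a') (b * c' - c * b').
Proof.
rewrite /comb !(lieDl, lieDr, lieZl, lieZr) !lie_lie !lie4 ?lie0r.
rewrite !liexx [lie y x]lieC !lieNr !(lie0r, subr0, sub0r, lieNr, lie4).
by vring.
Qed.

Let bch3_comb x y a b c d e a' b' c' d' e' :
  bch3 (comb x y a b c d e) (comb x y a' b' c' d' e') =
  comb x y (a + a') (b + b') (c + c' + 2^-1 * (a * b' - b * a'))
    (d + d' + 2^-1 * (a * c' - c * a')
     + 12^-1 * (a * (a * b' - b * a') - a' * (a * b' - b * a')))
    (e + e' + 2^-1 * (b * c' - c * b')
     + 12^-1 * (b * (a * b' - b * a') - b' * (a * b' - b * a'))).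
Proof. by rewrite /bch3 !lie_comb /comb; vring. Qed.

Let bch3_combxy x y :
  bch3 x y = comb x y 1 1 2^-1 12^-1 (- 12^-1).
Proof. by rewrite /bch3 [lie y x]lieC lieNr /comb; vring. Qed.

(** This is [exp (ad x)] applied to [y]; the series ends at second order by [lie4]. *)
Lemma bch3_conj x y :
  bch3 (bch3 x y) (- x) = y + lie x y + 2^-1 *: lie x (lie x y).
Proof.
rewrite (bch3_combxy x y).
have -> : - x = comb x y (- 1) 0 0 0 0 by rewrite /comb; vring.
by rewrite bch3_comb /comb; vfield.
Qed.

Lemma bch3_commutator x y :
  bch3 (bch3 x y) (bch3 (- x) (- y)) =
  lie x y + 2^-1 *: lie x (lie x y) + 2^-1 *: lie y (lie x y).
Proof.
have -> : bch3 (- x) (- y) = comb x y (- 1) (- 1) 2^-1 (- 12^-1) 12^-1.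
  by rewrite (bch3_combxy (- x)) /comb !(lieNl, lieNr, opprK); vring.
by rewrite (bch3_combxy x y) bch3_comb /comb; vfield.
Qed.

End Bch.

(** * The topology of a finite-dimensional Lie algebra *)

Section Topology.
Context {R : realType} {g : vectLieAlgType R}.
Local Notation n := (\dim {:g}).
Local Notation vecof := (passmx.vecof (vbasis {:g})).
Local Notation rVof := (passmx.rVof (vbasis {:g})).
Implicit Types (A B : set g).

Let rVofK : cancel rVof vecof := passmx.rVofK (vbasisP {:g}).
Let vecofK : cancel vecof rVof := passmx.vecofK (vbasisP {:g}).

(** [g] carries no topology of its own, so closedness is read in the same coordinates as in
    [lie_closure]. *)
Definition lie_closed A : Prop := closed [set p : 'rV[R]_n | A (vecof p)].

Definition lie_continuous (T : topologicalType) (F : T -> g) : Prop :=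
  forall i, continuous (fun t => co i (F t)).

Lemma rV_continuous (T : topologicalType) m (F : T -> 'rV[R]_m) :
  (forall i, continuous (fun t => F t 0 i)) -> continuous F.
Proof.
move=> cF t; apply/cvg_ballP => e e0.
have : \forall s \near t, forall i, ball (F t 0 i) e (F s 0 i).
  by apply: filter_forall => i; apply: (cvg_ball (cF i t)).
apply: filterS => s Fs; split=> // i j.
by rewrite [i]ord1; exact: Fs.
Qed.

Lemma sum_continuous (T : topologicalType) m (F : 'I_m -> T -> R) :
  (forall i, continuous (F i)) -> continuous (fun t => \sum_(i < m) F i t).
Proof.
by move=> cF; apply: continuous_big => [|i _]; [exact: add_continuous|exact: cF].
Qed.

Lemma preimage_lie_closed (T : topologicalType) (F : T -> g) A :
  lie_continuous F -> lie_closed A -> closed [set t | A (F t)].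
Proof.
move=> cF clA.
have cG : continuous (rVof \o F).
  apply: rV_continuous => i.
  have -> : (fun t => (rVof \o F) t 0 i) = (fun t => co i (F t)).
    by apply/funext => t; rewrite /= mxE.
  exact: cF.
have -> : [set t | A (F t)] = (rVof \o F) @^-1` [set p | A (vecof p)].
  by apply/seteqP; split=> t /=; rewrite rVofK.
exact: preimage_closed.
Qed.

Lemma lie_continuous_vecof : lie_continuous (vecof : 'rV[R]_n -> g).
Proof.
move=> i; have -> : (fun p => co i (vecof p)) = (fun p : 'rV[R]_n => p 0 i).
  by apply/funext => p; rewrite /co (passmx.coord_vecof (vbasisP {:g})).
exact: coord_continuous.
Qed.

Lemma lie_closed_preimage (F : g -> g) A :
  lie_continuous (fun p => F (vecof p)) -> lie_closed A ->
  lie_closed [set x | A (F x)].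
Proof. exact: preimage_lie_closed. Qed.

Lemma lie_closed_closure A : lie_closed (lie_closure A).
Proof.
rewrite /lie_closed /lie_closure.
have -> : [set p : 'rV[R]_n | [set x | closure (rVof @` A) (rVof x)] (vecof p)] =
    closure (rVof @` A) by apply/seteqP; split=> p /=; rewrite vecofK.
exact: closed_closure.
Qed.

Lemma sub_lie_closure A : A `<=` lie_closure A.
Proof. by move=> x Ax; apply: subset_closure; exists x. Qed.

Lemma lie_closure_min A B : lie_closed B -> A `<=` B -> lie_closure A `<=` B.
Proof.
move=> clB sAB x; rewrite /lie_closure closureE => /(_ _ (conj clB _)) /=.
rewrite rVofK; apply.
by move=> _ [y Ay <-] /=; rewrite rVofK; exact: sAB.
Qed.

Section Continuity.
Variable T : topologicalType.
Implicit Types F G : T -> g.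

Lemma lie_continuous_cst x : lie_continuous (fun _ : T => x).
Proof. by move=> i t; exact: cvg_cst. Qed.

Lemma lie_continuousD F G :
  lie_continuous F -> lie_continuous G -> lie_continuous (fun t => F t + G t).
Proof.
move=> cF cG i; rewrite (_ : (fun t => _) = (fun t => co i (F t) + co i (G t))).
  by move=> t; apply: cvgD; [exact: cF|exact: cG].
by apply/funext => t; rewrite coD.
Qed.

Lemma lie_continuousZ (a : T -> R) F :
  continuous a -> lie_continuous F -> lie_continuous (fun t => a t *: F t).
Proof.
move=> ca cF i; rewrite (_ : (fun t => _) = (fun t => a t * co i (F t))).
  by move=> t; apply: cvgM; [exact: ca|exact: cF].
by apply/funext => t; rewrite coZ.
Qed.

Lemma lie_continuous_linear (f : {linear g -> g}) F :
  lie_continuous F -> lie_continuous (fun t => f (F t)).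
Proof.
move=> cF i.
rewrite (_ : (fun t => _) =
    (fun t => \sum_(j < n) co j (F t) * co i (f (vbasis {:g})`_j))).
  apply: sum_continuous => j t; apply: cvgM; [exact: cF|exact: cvg_cst].
apply/funext => t; rewrite {1}(coord_vbasis (memvf (F t))) linear_sum.
rewrite /co linear_sum; apply: eq_bigr => j _.
by rewrite linearZ linearZ.
Qed.

Lemma scalar_continuous (f : {scalar g}) F :
  lie_continuous F -> continuous (fun t => f (F t)).
Proof.
move=> cF.
rewrite (_ : (fun t => _) =
    (fun t => \sum_(j < n) co j (F t) * f (vbasis {:g})`_j)).
  apply: sum_continuous => j t; apply: cvgM; [exact: cF|exact: cvg_cst].
apply/funext => t; rewrite {1}(coord_vbasis (memvf (F t))) linear_sum.
by apply: eq_bigr => j _; rewrite linearZ.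
Qed.

Lemma lie_continuous_lie F G :
  lie_continuous F -> lie_continuous G ->
  lie_continuous (fun t => lie (F t) (G t)).
Proof.
move=> cF cG i.
rewrite (_ : (fun t => _) = (fun t => \sum_(j < n) \sum_(k < n)
    co j (F t) * co k (G t) * co i (lie (vbasis {:g})`_j (vbasis {:g})`_k))).
  apply: sum_continuous => j; apply: sum_continuous => k t.
  by apply: cvgM; [apply: cvgM; [exact: cF|exact: cG]|exact: cvg_cst].
apply/funext => t; rewrite {1}(coord_vbasis (memvf (F t))) lie_suml.
rewrite {1}(coord_vbasis (memvf (G t))) [in LHS]/co linear_sum; apply: eq_bigr => j _.
rewrite lie_sumr linear_sum; apply: eq_bigr => k _.
by rewrite lieZl lieZr linearZ linearZ /= mulrA.
Qed.

Lemma lie_continuous_bch3 F G :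
  lie_continuous F -> lie_continuous G ->
  lie_continuous (fun t => bch3 (F t) (G t)).
Proof.
move=> cF cG; rewrite /bch3.
have ccst (a : R) : continuous (fun _ : T => a) by move=> t; exact: cvg_cst.
have cl := lie_continuous_lie; have cD := lie_continuousD.
have cZ (a : R) (H : T -> g) : lie_continuous H -> lie_continuous (fun t => a *: H t).
  by move=> cH; exact: lie_continuousZ (ccst a) cH.
apply: (cD); first apply: (cD); first exact: cD.
  by apply: cZ; exact: cl.
by apply: cZ; apply: cD; (apply: (cl); first by []); exact: cl.
Qed.

End Continuity.

(* Separate continuity of the product suffices. *)
Lemma lie_closure_bch3 A :
  (forall x y, A x -> A y -> A (bch3 x y)) ->
  forall x y, lie_closure A x -> lie_closure A y -> lie_closure A (bch3 x y).
Proof.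
move=> Abch.
have cst x : lie_continuous (fun _ : 'rV[R]_n => x) by exact: lie_continuous_cst.
have cvec := lie_continuous_vecof.
(* The left factor is first kept in [A] while the right one moves to the closure; then the right
   factor is fixed. *)
have Al x : A x -> forall y, lie_closure A y -> lie_closure A (bch3 x y).
  move=> Ax; apply: lie_closure_min.
    by apply: lie_closed_preimage; [exact: lie_continuous_bch3|exact: lie_closed_closure].
  by move=> y Ay; apply: sub_lie_closure; exact: Abch.
move=> x y clx cly; move: x clx; apply: lie_closure_min.
  apply: (@lie_closed_preimage (bch3^~ y)); first exact: lie_continuous_bch3.
  exact: lie_closed_closure.
by move=> x Ax; exact: Al.
Qed.

(** Dilations are available for positive parameters only, so the limit is taken along right
    neighbourhoods of 0. *)
Lemma lie_closed_lim A a b c :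
  lie_closed A -> (forall e : R, 0 < e -> A (c + e *: b + e ^+ 2 *: a)) -> A c.
Proof.
move=> clA Ae.
have cid : continuous (fun e : R => e) by move=> e; exact: cvg_id.
have cF : lie_continuous (fun e : R => c + e *: b + e ^+ 2 *: a).
  apply: lie_continuousD; first apply: lie_continuousD.
  - exact: lie_continuous_cst.
  - by apply: lie_continuousZ => //; exact: lie_continuous_cst.
  - by apply: lie_continuousZ; [exact: exprn_continuous|exact: lie_continuous_cst].
have clD := preimage_lie_closed cF clA.
suff : [set t : R | A (c + t *: b + t ^+ 2 *: a)] 0.
  by rewrite /= expr0n /= !scale0r !addr0.
apply: (@closed_cvg R R 0^'+ _ id _ clD); last exact: (cvg_at_right_filter (cid 0)).
near=> e; apply: Ae; near: e; exact: nbhs_right_gt.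
Unshelve. all: by end_near.
Qed.

End Topology.

(** * Closed convex cones *)

Section Separation.
Context {R : realType} {m : nat}.
Implicit Types (u v w p : 'rV[R]_m).

Let dot u v : R := \sum_i u 0 i * v 0 i.

Let dotDr u v w : dot u (v + w) = dot u v + dot u w.
Proof. by rewrite -big_split; apply: eq_bigr => i _; rewrite mxE mulrDr. Qed.

Let dotZr u a v : dot u (a *: v) = a * dot u v.
Proof. by rewrite mulr_sumr; apply: eq_bigr => i _; rewrite mxE mulrCA. Qed.

Let dotC u v : dot u v = dot v u.
Proof. by apply: eq_bigr => i _; rewrite mulrC. Qed.

Let dot_ge0 u : 0 <= dot u u.
Proof. by apply: sumr_ge0 => i _; rewrite -expr2 sqr_ge0. Qed.

Let dot_eq0 u : dot u u = 0 -> u = 0.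
Proof.
move/eqP; rewrite psumr_eq0 => [/allP u0|i _]; last by rewrite -expr2 sqr_ge0.
apply/rowP => i; rewrite mxE; apply/eqP.
by have := u0 i (mem_index_enum i); rewrite /= -expr2 sqrf_eq0.
Qed.

Let dot_sqr u v (t : R) : dot (u + t *: v) (u + t *: v) =
  dot u u + 2 * t * dot u v + t ^+ 2 * dot v v.
Proof.
rewrite dotDr dotZr (dotC (u + _) u) (dotC (u + _) v) !dotDr !dotZr (dotC v u).
by ring.
Qed.

(** The first-order condition at a minimum. If [a < 0], then [t = - a / (b - a)] lies in the allowed
    range and turns the expression into [t * a * (1 + t)], which is negative. *)
Let slope_ge0 (a b : R) : 0 <= b ->
  (forall t, 0 < t <= 1 -> 0 <= 2 * t * a + t ^+ 2 * b) -> 0 <= a.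
Proof.
move=> b0 ab; rewrite leNgt; apply/negP => a0.
have ba : 0 < b - a by lra.
pose t := - a / (b - a).
have tba : t * (b - a) = - a by rewrite /t divfK// gt_eqF.
have t0 : 0 < t by rewrite divr_gt0//; lra.
have t1 : t <= 1 by rewrite ler_pdivrMr//; lra.
have := ab t; rewrite t0 t1 => /(_ isT); apply/negP; rewrite -ltNge.
have -> : 2 * t * a + t ^+ 2 * b = t * (2 * a + t * b) by ring.
rewrite pmulr_rlt0//; nra.
Qed.

(* The functional is the inner product with [c - x], where [c] is the point of
   the cone nearest to [x]. *)
Lemma closed_cone_separation (C : set 'rV[R]_m) x :
  closed C -> C 0 -> (forall p q, C p -> C q -> C (p + q)) ->
  (forall (a : R) p, 0 < a -> C p -> C (a *: p)) -> ~ C x ->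
  exists w, (forall p, C p -> 0 <= \sum_i w 0 i * p 0 i) /\
    \sum_i w 0 i * x 0 i < 0.
Proof.
move=> clC C0 CD CZ Cx.
pose f p := dot (p - x) (p - x).
have cf : continuous f.
  apply: (@continuous_big _ _ +%R 0) => [|i _]; first exact: add_continuous.
  have cg : continuous (fun p => (p - x) 0 i).
    rewrite (_ : (fun p => _) = (fun p : 'rV[R]_m => p 0 i - x 0 i)).
      have ci : continuous (fun p : 'rV[R]_m => p 0 i) by exact: coord_continuous.
      by move=> p; apply: (cvgB (ci p)); exact: cvg_cst.
    by apply/funext => p; rewrite !mxE.
  by move=> p; exact: (cvgM (cg p) (cg p)).
(* Cutting the cone down to the points no farther from [x] than 0 makes it compact and keeps the
   minimum of the distance. *)
pose A := C `&` [set p | f p <= f 0].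
have A0 : A 0 by split=> //=.
have cA : compact A.
  (* Since [f 0 <= M ^+ 2], this bounds each coordinate of [p - x] without a square root. *)
  pose M := f 0 + 1.
  have cB : compact [set p : 'rV[R]_m |
      forall i, `[x 0 i - M, x 0 i + M]%classic (p 0 i)].
    apply: (@rV_compact R m (fun i => `[x 0 i - M, x 0 i + M]%classic)) => i.
    exact: segment_compact.
  apply: subclosed_compact cB _.
  - apply: closedI => //; rewrite (_ : [set p | _] = f @^-1` [set y | y <= f 0]) //.
    by apply: preimage_closed => //; exact: closed_le.
  - move=> p [_ /= fp] i; rewrite in_itv /=.
    have : (p 0 i - x 0 i) ^+ 2 <= f 0.
      apply: le_trans fp; rewrite /f /dot (bigD1 i) //= !mxE -expr2 lerDl.
      by apply: sumr_ge0 => j _; rewrite -expr2 sqr_ge0.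
    have := dot_ge0 (0 - x); rewrite -/(f 0) /M => f0 d.
    by apply/andP; split; nra.
have [c] : exists2 c, c \in A & forall t, t \in A -> f c <= f t.
  by apply: compact_EVT_min => //; [exists 0|exact: continuous_subspaceT].
rewrite inE => -[Cc fc] minc.
have {}minc p : C p -> f c <= f p.
  move=> Cp; case: (leP (f p) (f 0)) => [fp|fp].
    by apply: minc; rewrite inE; split.
  exact: le_trans fc (ltW fp).
(* Moving from [c] inside the cone cannot bring it closer to [x]. *)
have wP k : (forall t : R, 0 < t <= 1 -> C (c + t *: k)) -> 0 <= dot (c - x) k.
  move=> Ck; apply: (@slope_ge0 _ (dot k k)) => // t t01.
  have := minc _ (Ck t t01); rewrite /f.
  have -> : c + t *: k - x = (c - x) + t *: k by rewrite addrAC.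
  by rewrite dot_sqr -addrA lerDl.
exists (c - x); split=> [p Cp|]; rewrite -/(dot _ _).
  by apply: wP => t /andP[t0 _]; apply: CD => //; exact: CZ.
(* The direction [- c] is allowed, as [(1 - t) *: c] stays in the cone, also at [t = 1], where it is
   0. *)
have wc : dot (c - x) c <= 0.
  have := wP (- c); rewrite -[- c]scaleN1r dotZr mulN1r oppr_ge0; apply.
  move=> t /andP[t0 t1]; rewrite scalerA mulrN1 scaleNr -{1}[c]scale1r -scalerBl.
  case: (ltP t 1) => [t1'|t1']; first by apply: CZ => //; lra.
  by rewrite (_ : 1 - t = 0) ?scale0r//; lra.
have cE : x + (c - x) = c by rewrite addrC subrK.
have := dotDr (c - x) x (c - x); rewrite cE => wE.
suff : 0 < dot (c - x) (c - x) by lra.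
rewrite lt_def dot_ge0 andbT; apply/eqP => /dot_eq0 /eqP; rewrite subr_eq0 => /eqP cx.
by apply: Cx; rewrite -cx.
Qed.

End Separation.

Section DualCone.
Context {R : realType} {g : vectLieAlgType R}.
Implicit Types (x y : g) (C : set g).
Local Notation vecof := (passmx.vecof (vbasis {:g})).
Local Notation rVof := (passmx.rVof (vbasis {:g})).

Lemma lie_closed_cone_separation C x :
  lie_closed C -> C 0 -> (forall y z, C y -> C z -> C (y + z)) ->
  (forall (a : R) y, 0 < a -> C y -> C (a *: y)) -> ~ C x ->
  exists2 mu : {scalar g}, (forall y, C y -> 0 <= mu y) & mu x < 0.
Proof.
move=> clC C0 CD CZ Cx.
have rVofK : cancel rVof vecof := passmx.rVofK (vbasisP {:g}).
have v0 : vecof 0 = 0 by exact: linear0.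
have vD p q : vecof (p + q) = vecof p + vecof q by exact: linearD.
have vZ (a : R) p : vecof (a *: p) = a *: vecof p by exact: linearZ.
have [||||w [wC wx]] := closed_cone_separation (x := rVof x) clC.
- by rewrite /mkset v0.
- by move=> p q; rewrite /mkset vD; exact: CD.
- by move=> a p a0; rewrite /mkset vZ; exact: CZ.
- by rewrite /mkset rVofK.
have lw : scalar (fun y => \sum_i w 0 i * rVof y 0 i).
  move=> a y z; rewrite linearP mulr_sumr -big_split; apply: eq_bigr => i _.
  by rewrite !mxE mulrDr mulrCA.
pose mu : {scalar g} := HB.pack (fun y => \sum_i w 0 i * rVof y 0 i)
  (GRing.isLinear.Build _ _ _ _ _ lw).
exists mu => // y Cy; apply: wC; rewrite /= rVofK.
exact: Cy.
Qed.

(* As long as the face [C `&` ker mu] contains some [x] with [- x] not in [C],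
   adding to [mu] a functional that separates [- x] from [C] lowers the dimension
   of the span of the face. *)
Lemma dual_cone_face C :
  lie_closed C -> C 0 -> (forall y z, C y -> C z -> C (y + z)) ->
  (forall (a : R) y, 0 < a -> C y -> C (a *: y)) ->
  exists2 mu : {scalar g}, (forall y, C y -> 0 <= mu y) &
    forall y, C y -> mu y = 0 -> C (- y).
Proof.
move=> clC C0 CD CZ.
(* Induction on a bound for the dimension of a subspace [D] that contains the face cut out by
   [mu]. *)
suff H k (D : {vspace g}) (mu : {scalar g}) : (\dim D <= k)%N ->
    (forall y, C y -> 0 <= mu y) -> (forall y, C y -> mu y = 0 -> y \in D) ->
    exists2 nu : {scalar g}, (forall y, C y -> 0 <= nu y) &
      forall y, C y -> nu y = 0 -> C (- y).
  by apply: (H _ fullv \0 (leqnn _)) => // y _ _; rewrite memvf.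
elim: k D mu => [|k IHk] D mu dD mu0 muD.
  exists mu => // y Cy /(muD _ Cy); move: dD; rewrite leqn0 dimv_eq0 => /eqP ->.
  by rewrite memv0 => /eqP ->; rewrite oppr0.
have [H|] := pselect (forall y, C y -> mu y = 0 -> C (- y)); first by exists mu.
move=> /existsNP[x /not_implyP[Cx /not_implyP[mux Cnx]]].
have [nu nu0 nux] := lie_closed_cone_separation clC C0 CD CZ Cnx.
pose nuo : {linear g -> R^o} := nu.
apply: (IHk (D :&: lker (linfun nuo))%VS (mu \+ nu)).
(* The dimension drops because [x] is in [D] but not in the kernel of [nu]. *)
- rewrite -ltnS; apply: leq_trans dD; rewrite ltn_neqAle dimvS ?capvSl// andbT.
  apply/eqP => eqD.
  have DE : (D :&: lker (linfun nuo) = D)%VS.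
    by apply/eqP; rewrite eqEdim capvSl eqD leqnn.
  have := muD _ Cx mux; rewrite -DE memv_cap memv_ker lfunE /= => /andP[_ /eqP nx0].
  by move: nux; rewrite linearN [nu x]nx0 oppr0 ltxx.
- by move=> y Cy /=; rewrite addr_ge0 ?mu0 ?nu0.
- move=> y Cy /= /eqP; rewrite paddr_eq0 ?mu0 ?nu0// => /andP[/eqP m0 /eqP n0].
  by rewrite memv_cap muD// memv_ker lfunE /= [nuo y]n0 eqxx.
Qed.

End DualCone.

(** * Gradings of step at most 3 *)

Section Brackets.
Context {K : fieldType} {g : vectLieAlgType K}.
Implicit Types (U W : {vspace g}).

Lemma memv_liev U W u w : u \in U -> w \in W -> lie u w \in liev U W.
Proof.
move=> Uu Ww; rewrite (coord_vbasis Uu) (coord_vbasis Ww) lie_suml.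
apply: memv_suml => i _; rewrite lie_sumr; apply: memv_suml => j _.
rewrite lieZl lieZr !memvZ// memv_span//; apply: allpairs_f; apply: mem_nth.
  by rewrite size_tuple.
by rewrite size_tuple.
Qed.

Lemma liev_ind U W (P : g -> Prop) :
  P 0 -> (forall x y, P x -> P y -> P (x + y)) ->
  (forall a x, P x -> P (a *: x)) ->
  (forall u w, u \in U -> w \in W -> P (lie u w)) ->
  forall x, x \in liev U W -> P x.
Proof.
move=> P0 PD PZ Pl x; rewrite /liev; set s := [seq _ | _ <- _, _ <- _].
move=> xs; rewrite (@coord_span _ _ _ (in_tuple s) x xs).
apply: big_ind => // i _; apply: PZ.
have /allpairsP[[u w] /= [uU wW ->]] : (in_tuple s)`_i \in s by apply: mem_nth.
by apply: Pl; exact: vbasis_mem.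
Qed.

(* A stratification of step at most 3, completed by zero layers up to step 3 *)
Record grading3 (V1 V2 V3 : {vspace g}) : Prop := Grading3 {
  grading3_full : (V1 + (V2 + V3) = fullv)%VS;
  grading3_cap1 : (V1 :&: (V2 + V3) = 0)%VS;
  grading3_cap2 : (V2 :&: V3 = 0)%VS;
  grading3_lie11 : liev V1 V1 = V2;
  grading3_lie12 : liev V1 V2 = V3;
  grading3_lie13 : liev V1 V3 = 0%VS
}.

Lemma liev0 U : liev U 0 = 0%VS.
Proof.
apply/eqP; rewrite -subv0; apply/subvP; apply: liev_ind => [|x y|a x|u w _].
- exact: mem0v.
- exact: memvD.
- exact: memvZ.
- by rewrite memv0 => /eqP ->; rewrite lie0r mem0v.
Qed.

(** The last clause carries homogeneity of an ideal from the three completed layers back to the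
    original stratification. *)
Lemma stratification_grading3 (s : nat) (V : nat -> {vspace g}) :
  stratification s V -> (s <= 3)%N ->
  exists V2 V3, grading3 (V 1%N) V2 V3 /\
    forall I, (I = (I :&: V 1%N) + ((I :&: V2) + (I :&: V3)))%VS ->
      homogeneous s V I.
Proof.
case: s => [|[|[|[|//]]]] [] // _ /directv_sumP dir full lj ls _ _.
- move: full; rewrite big_ord_recl big_ord0 addv0 => full.
  exists 0%VS, 0%VS; split; first split; rewrite ?liev0 ?addv0 ?capv0 //.
  by move=> I; rewrite /homogeneous big_ord_recl big_ord0 ?capv0 ?addv0.
- move: full; rewrite !big_ord_recl big_ord0 addv0 => full.
  exists (V 2%N), 0%VS; split; first split; rewrite ?liev0 ?addv0 ?capv0 //.
  + have := dir ord0 isT; rewrite big_mkcond !big_ord_recl big_ord0 /=.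
    by rewrite add0v addv0.
  + exact: lj.
  + by move=> I; rewrite /homogeneous !big_ord_recl big_ord0 ?capv0 ?addv0.
- move: full; rewrite !big_ord_recl big_ord0 addv0 => full.
  exists (V 2%N), (V 3%N); split; first split => //.
  + have := dir ord0 isT; rewrite big_mkcond !big_ord_recl big_ord0 /=.
    by rewrite add0v addv0.
  + have := dir (lift ord0 ord0) isT; rewrite big_mkcond !big_ord_recl big_ord0 /=.
    rewrite addv0 add0v => h; apply/eqP; rewrite -subv0 -h.
    by rewrite capvS// addvSr.
  + exact: lj.
  + exact: (lj 2%N).
  + by move=> I; rewrite /homogeneous !big_ord_recl big_ord0 !addv0.
Qed.

End Brackets.

Section Grading.
Context {K : fieldType} {g : vectLieAlgType K} {V1 V2 V3 : {vspace g}}.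
Hypothesis G : grading3 V1 V2 V3.
Implicit Types x y z v : g.

Definition pr1 : 'End(g) := daddv_pi V1 (V2 + V3).
Definition pr23 : 'End(g) := daddv_pi (V2 + V3) V1.
Definition pr2 : 'End(g) := (daddv_pi V2 V3 \o pr23)%VF.
Definition pr3 : 'End(g) := (daddv_pi V3 V2 \o pr23)%VF.

Lemma pr_sum v : v = pr1 v + pr2 v + pr3 v.
Proof.
rewrite /pr2 /pr3 !comp_lfunE -addrA daddv_pi_add ?(grading3_cap2 G)//.
  by rewrite /pr1 /pr23 daddv_pi_add ?(grading3_cap1 G)// (grading3_full G) memvf.
exact: memv_pi.
Qed.

Lemma memv_pr1 v : pr1 v \in V1.
Proof. exact: memv_pi. Qed.
Lemma memv_pr2 v : pr2 v \in V2.
Proof. by rewrite comp_lfunE memv_pi. Qed.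
Lemma memv_pr3 v : pr3 v \in V3.
Proof. by rewrite comp_lfunE memv_pi. Qed.

Let cap1 := grading3_cap1 G.
Let cap1' : ((V2 + V3) :&: V1 = 0)%VS. Proof. by rewrite capvC. Qed.
Let cap2 := grading3_cap2 G.
Let cap2' : (V3 :&: V2 = 0)%VS. Proof. by rewrite capvC. Qed.

Let daddv_pi_0 (U W : {vspace g}) w :
  (U :&: W = 0)%VS -> w \in W -> daddv_pi U W w = 0.
Proof.
move=> UW Ww; have := daddv_pi_add UW (subvP (addvSr U W) _ Ww).
rewrite capvC in UW; rewrite (daddv_pi_id UW)// => /(canRL (addrK w)) ->.
by rewrite subrr.
Qed.

Lemma prV1 v : v \in V1 -> [/\ pr1 v = v, pr2 v = 0 & pr3 v = 0].
Proof.
move=> vV; rewrite /pr2 /pr3 !comp_lfunE /pr1 /pr23.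
by rewrite (daddv_pi_id cap1)// (daddv_pi_0 cap1')// !linear0.
Qed.

Lemma prV2 v : v \in V2 -> [/\ pr1 v = 0, pr2 v = v & pr3 v = 0].
Proof.
move=> vV; have vV' : v \in (V2 + V3)%VS by exact: (subvP (addvSl _ _)).
rewrite /pr2 /pr3 !comp_lfunE /pr1 /pr23.
rewrite (daddv_pi_0 cap1)// (daddv_pi_id cap1')//.
by rewrite (daddv_pi_id cap2)// (daddv_pi_0 cap2').
Qed.

Lemma prV3 v : v \in V3 -> [/\ pr1 v = 0, pr2 v = 0 & pr3 v = v].
Proof.
move=> vV; have vV' : v \in (V2 + V3)%VS by exact: (subvP (addvSr _ _)).
rewrite /pr2 /pr3 !comp_lfunE /pr1 /pr23.
rewrite (daddv_pi_0 cap1)// (daddv_pi_id cap1')//.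
by rewrite (daddv_pi_id cap2')// (daddv_pi_0 cap2).
Qed.

Lemma lie11 x y : x \in V1 -> y \in V1 -> lie x y \in V2.
Proof. by rewrite -(grading3_lie11 G); exact: memv_liev. Qed.

Lemma lie12 x y : x \in V1 -> y \in V2 -> lie x y \in V3.
Proof. by move=> Vx; rewrite -(grading3_lie12 G); exact: memv_liev. Qed.

Lemma lie21 x y : x \in V2 -> y \in V1 -> lie x y \in V3.
Proof. by move=> Vx Vy; rewrite lieC memvN lie12. Qed.

Lemma lie13 x y : x \in V1 -> y \in V3 -> lie x y = 0.
Proof.
by move=> Vx Vy; apply/eqP; rewrite -memv0 -(grading3_lie13 G) memv_liev.
Qed.

(** A grading prescribes only brackets with [V1]. Here and in the next two lemmas, an element of a
    higher layer is written as a sum of brackets and the Jacobi identity reduces the claim to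
    those. *)
Lemma lie23 x y : x \in V2 -> y \in V3 -> lie x y = 0.
Proof.
move=> + Vy; rewrite -(grading3_lie11 G); move: x.
apply: liev_ind => [|x z x0 z0|a x x0|u w Vu Vw]; rewrite ?lie0l//.
- by rewrite lieDl x0 z0 addr0.
- by rewrite lieZl x0 scaler0.
- by rewrite lie_lie !(lie13 _ Vy)// !lie0r subr0.
Qed.

Lemma lie33 x y : x \in V3 -> y \in V3 -> lie x y = 0.
Proof.
move=> + Vy; rewrite -(grading3_lie12 G); move: x.
apply: liev_ind => [|x z x0 z0|a x x0|u w Vu Vw]; rewrite ?lie0l//.
- by rewrite lieDl x0 z0 addr0.
- by rewrite lieZl x0 scaler0.
- by rewrite lie_lie (lie23 _ Vy)// (lie13 _ Vy)// !lie0r subr0.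
Qed.

Lemma lie22 x y : x \in V2 -> y \in V2 -> lie x y = 0.
Proof.
move=> + Vy; rewrite -(grading3_lie11 G); move: x.
apply: liev_ind => [|x z x0 z0|a x x0|u w Vu Vw]; rewrite ?lie0l//.
- by rewrite lieDl x0 z0 addr0.
- by rewrite lieZl x0 scaler0.
- by rewrite lie_lie (lie13 Vu (lie12 Vw Vy)) (lie13 Vw (lie12 Vu Vy)) subr0.
Qed.

Lemma lie_V3 x z : z \in V3 -> lie x z = 0.
Proof.
move=> Vz; rewrite (pr_sum x) !lieDl (lie13 (memv_pr1 x) Vz) (lie23 (memv_pr2 x) Vz).
by rewrite (lie33 (memv_pr3 x) Vz) !addr0.
Qed.

Lemma lieV3_ x z : z \in V3 -> lie z x = 0.
Proof. by move=> Vz; rewrite lieC lie_V3// oppr0. Qed.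

Lemma lie_V2 x z : z \in V2 -> lie x z = lie (pr1 x) z.
Proof.
move=> Vz; rewrite {1}(pr_sum x) !lieDl (lie22 (memv_pr2 x) Vz).
by rewrite (lieV3_ _ (memv_pr3 x)) !addr0.
Qed.

Lemma lie_pr x y :
  lie x y = lie (pr1 x) (pr1 y) + (lie (pr1 x) (pr2 y) + lie (pr2 x) (pr1 y)).
Proof.
rewrite {1}(pr_sum y) !lieDr (lie_V3 _ (memv_pr3 y)) addr0.
rewrite (lie_V2 _ (memv_pr2 y)) {1}(pr_sum x) !lieDl.
by rewrite (lieV3_ _ (memv_pr3 x)) addr0 -addrA [_ + lie (pr1 x) (pr2 y)]addrC.
Qed.

Lemma pr1_lie x y : pr1 (lie x y) = 0.
Proof.
rewrite lie_pr !linearD /=.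
have [-> _ _] := prV2 (lie11 (memv_pr1 x) (memv_pr1 y)).
have [-> _ _] := prV3 (lie12 (memv_pr1 x) (memv_pr2 y)).
by have [-> _ _] := prV3 (lie21 (memv_pr2 x) (memv_pr1 y)); rewrite !addr0.
Qed.

Lemma pr2_lie x y : pr2 (lie x y) = lie (pr1 x) (pr1 y).
Proof.
rewrite lie_pr !linearD /=.
have [_ -> _] := prV2 (lie11 (memv_pr1 x) (memv_pr1 y)).
have [_ -> _] := prV3 (lie12 (memv_pr1 x) (memv_pr2 y)).
by have [_ -> _] := prV3 (lie21 (memv_pr2 x) (memv_pr1 y)); rewrite !addr0.
Qed.

Lemma pr3_lie x y :
  pr3 (lie x y) = lie (pr1 x) (pr2 y) + lie (pr2 x) (pr1 y).
Proof.
rewrite lie_pr !linearD /=.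
have [_ _ ->] := prV2 (lie11 (memv_pr1 x) (memv_pr1 y)).
have [_ _ ->] := prV3 (lie12 (memv_pr1 x) (memv_pr2 y)).
by have [_ _ ->] := prV3 (lie21 (memv_pr2 x) (memv_pr1 y)); rewrite add0r.
Qed.

Lemma lie4_eq0 x y z v : lie x (lie y (lie z v)) = 0.
Proof.
apply: lie_V3; rewrite lie_pr pr1_lie lie0r lie0r add0r addr0 lie12 ?memv_pr1 ?memv_pr2//.
Qed.

(** The dilations of the Carnot group: they respect brackets, hence also the product [bch3]. *)
Definition dil (t : K) v : g := t *: pr1 v + t ^+ 2 *: pr2 v + t ^+ 3 *: pr3 v.

Lemma dilD t x y : dil t (x + y) = dil t x + dil t y.
Proof. by rewrite /dil !linearD /=; vring. Qed.

Lemma dilZ t a x : dil t (a *: x) = a *: dil t x.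
Proof. by rewrite /dil !linearZ /=; vring. Qed.

Lemma dilV1 t v : v \in V1 -> dil t v = t *: v.
Proof. by move=> /prV1[v1 v2 v3]; rewrite /dil v1 v2 v3 !scaler0 !addr0. Qed.

Lemma dilV2 t v : v \in V2 -> dil t v = t ^+ 2 *: v.
Proof. by move=> /prV2[v1 v2 v3]; rewrite /dil v1 v2 v3 !scaler0 !addr0 add0r. Qed.

Lemma dilV3 t v : v \in V3 -> dil t v = t ^+ 3 *: v.
Proof. by move=> /prV3[v1 v2 v3]; rewrite /dil v1 v2 v3 !scaler0 !add0r. Qed.

Lemma pr_comb a b c : a \in V1 -> b \in V2 -> c \in V3 ->
  [/\ pr1 (a + b + c) = a, pr2 (a + b + c) = b & pr3 (a + b + c) = c].
Proof.
move=> /prV1[a1 a2 a3] /prV2[b1 b2 b3] /prV3[c1 c2 c3].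
by rewrite !linearD /= a1 a2 a3 b1 b2 b3 c1 c2 c3 !addr0 !add0r.
Qed.

Lemma dil_lie t x y : dil t (lie x y) = lie (dil t x) (dil t y).
Proof.
have [] := pr_comb (memvZ t (memv_pr1 x)) (memvZ (t ^+ 2) (memv_pr2 x))
  (memvZ (t ^+ 3) (memv_pr3 x)); rewrite -/(dil t x) => x1 x2 _.
have [] := pr_comb (memvZ t (memv_pr1 y)) (memvZ (t ^+ 2) (memv_pr2 y))
  (memvZ (t ^+ 3) (memv_pr3 y)); rewrite -/(dil t y) => y1 y2 _.
rewrite [RHS]lie_pr x1 x2 y1 y2 /dil pr1_lie pr2_lie pr3_lie !(lieZl, lieZr).
by vring.
Qed.

End Grading.

Arguments pr1 {K g} V1 V2 V3.
Arguments pr2 {K g} V1 V2 V3.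
Arguments pr3 {K g} V1 V2 V3.
Arguments dil {K g} V1 V2 V3.

(** * Closed semigroups that contain a horizontal half-space *)

Section HalfSpaceSemigroup.
Context {R : realType} {g : vectLieAlgType R} {V1 V2 V3 : {vspace g}}.
Hypothesis G : grading3 V1 V2 V3.
Implicit Types x y z u v w : g.

Local Notation pr1 := (pr1 V1 V2 V3).
Local Notation pr2 := (pr2 V1 V2 V3).
Local Notation pr3 := (pr3 V1 V2 V3).
Local Notation dil := (dil V1 V2 V3).

Lemma bch3_V3 x z : z \in V3 -> bch3 x z = x + z.
Proof.
move=> Vz; rewrite /bch3 (lie_V3 G _ Vz) (lieV3_ G _ Vz) !lie0r.
by rewrite !(addr0, scaler0).
Qed.

Lemma bch3_V2 x y : x \in V2 -> y \in V2 -> bch3 x y = x + y.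
Proof.
move=> Vx Vy; rewrite /bch3 (lie22 G Vx Vy) (lie22 G Vy Vx) !lie0r.
by rewrite !(addr0, scaler0).
Qed.

Lemma dil_bch3 t x y : dil t (bch3 x y) = bch3 (dil t x) (dil t y).
Proof. by rewrite /bch3 -!dil_lie// -!dilD -!dilZ -!dilD. Qed.

Lemma pr1_bch3 x y : pr1 (bch3 x y) = pr1 x + pr1 y.
Proof. by rewrite /bch3 !(linearD, linearZ) /= !(pr1_lie G) !(addr0, scaler0). Qed.

Lemma pr1_commutator_subgroup x : commutator_subgroup x -> pr1 x = 0.
Proof.
elim=> [y z||y z _ y0 _ z0|y _ y0].
- by rewrite !pr1_bch3 !linearN /= addrACA !subrr addr0.
- exact: linear0.
- by rewrite pr1_bch3 y0 z0 addr0.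
- by rewrite linearN /= y0 oppr0.
Qed.

(** Dilations act on [V3] by [t ^+ 3]; cube roots therefore make [S] invariant under positive
    scalars on [V3]. *)
Lemma cube_root (a : R) : 0 < a -> exists2 t : R, 0 < t & t ^+ 3 = a.
Proof.
move=> a0; exists (a `^ 3^-1); first by rewrite powR_gt0.
by rewrite -powR_mulrn ?powR_ge0// -powRrM mulVf ?pnatr_eq0// powRr1 ?ltW.
Qed.

Section HalfSpace.
Variable W : set g.
Hypothesis W_V1 : forall v, W v -> v \in V1.
Hypothesis WZ : forall (a : R) v, 0 < a -> W v -> W (a *: v).

Local Notation S := (lie_closure (semigroup_gen W)).

Lemma closure_semigroup_bch3 x y : S x -> S y -> S (bch3 x y).
Proof. by apply: lie_closure_bch3; exact: semigroup_gen_mul. Qed.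

(** A dilation is a continuous endomorphism of the group that maps [W] into itself. *)
Lemma closure_semigroup_dil (t : R) x : 0 < t -> S x -> S (dil t x).
Proof.
move=> t0; apply: (@lie_closure_min _ _ _ [set y | S (dil t y)]).
  apply: lie_closed_preimage; last exact: lie_closed_closure.
  have cpr (f : 'End(g)) : lie_continuous
      (fun p : 'rV[R]_(\dim {:g}) => f (vecof (vbasis {:g}) p)).
    exact: (lie_continuous_linear lie_continuous_vecof).
  have cc (a : R) (f : 'End(g)) : lie_continuous
      (fun p : 'rV[R]_(\dim {:g}) => a *: f (vecof (vbasis {:g}) p)).
    have ca : continuous (fun _ : 'rV[R]_(\dim {:g}) => a) by exact: cst_continuous.
    exact: (lie_continuousZ ca (cpr f)).
  by apply: lie_continuousD; first apply: lie_continuousD.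
move=> y; elim=> {y} [y Wy|y z _ IHy _ IHz]; last first.
  have Sy : S (dil t y) := IHy.
  have Sz : S (dil t z) := IHz.
  by rewrite /mkset dil_bch3; exact: (closure_semigroup_bch3 Sy Sz).
rewrite /mkset (dilV1 G) ?W_V1//; apply: sub_lie_closure.
by apply: semigroup_gen_in; exact: WZ.
Qed.

End HalfSpace.

Definition invertible_in (S : set g) x : Prop := S x /\ S (- x).

(** What the argument retains of the closed semigroup generated by a half-space with edge [U] and
    inner normal [X]. *)
Record horizontal_semigroup (U : {vspace g}) (X : g) (S : set g) : Prop := {
  hsg_X : X \in V1;
  hsg_sub : (U <= V1)%VS;
  hsg_span : forall v, v \in V1 ->
    exists (a : R) (u : g), u \in U /\ v = a *: X + u;
  hsg_closed : lie_closed S;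
  hsg_bch3 : forall x y, S x -> S y -> S (bch3 x y);
  hsg_dil : forall (t : R) x, 0 < t -> S x -> S (dil t x);
  hsg_memU : forall u, u \in U -> S u;
  hsg_memX : S X
}.

Section HorizontalSemigroup.
Variables (U : {vspace g}) (X : g) (S : set g).
Hypothesis HS : horizontal_semigroup U X S.

Let V1X := hsg_X HS.
Let subUV := hsg_sub HS.
Let V1E := hsg_span HS.
Let S_closed := hsg_closed HS.
Let S_bch := hsg_bch3 HS.
Let S_dil := hsg_dil HS.
Let S_U := hsg_memU HS.
Let S_X := hsg_memX HS.

Local Notation unitS := (invertible_in S).

Let UV u : u \in U -> u \in V1. Proof. by move=> Uu; exact: (subvP subUV). Qed.

Let S_lim a b c : (forall e : R, 0 < e -> S (c + e *: b + e ^+ 2 *: a)) -> S c.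
Proof. exact: lie_closed_lim. Qed.

Lemma S_V3Z (a : R) z : 0 < a -> z \in V3 -> S z -> S (a *: z).
Proof.
move=> a0 Vz Sz; have [t t0 <-] := cube_root a0.
by rewrite -(dilV3 G)//; exact: S_dil.
Qed.

Lemma invertibleN x : unitS x -> unitS (- x).
Proof. by case=> Sx Snx; split; rewrite ?opprK. Qed.

Lemma invertible_bch x y : unitS x -> unitS y -> unitS (bch3 x y).
Proof.
by move=> [Sx Snx] [Sy Sny]; split; rewrite -?bch3N; exact: S_bch.
Qed.

Lemma invertible_U u : u \in U -> unitS u.
Proof. by move=> Uu; split; apply: S_U; rewrite ?memvN. Qed.

Lemma invertible0 : unitS 0.
Proof. by apply: invertible_U; exact: mem0v. Qed.

Lemma invertible_dil (t : R) x : 0 < t -> unitS x -> unitS (dil t x).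
Proof.
move=> t0 [Sx Snx]; split; first exact: S_dil.
by rewrite -scaleN1r -dilZ scaleN1r; exact: S_dil.
Qed.

(** Dilations by square roots give the positive scalars on [V2], and inversion gives the negative
    ones. *)
Lemma invertible_V2Z (a : R) z : z \in V2 -> unitS z -> unitS (a *: z).
Proof.
move=> Vz; have pos b w : w \in V2 -> 0 < b -> unitS w -> unitS (b *: w).
  move=> Vw b0 Hw; rewrite -(sqr_sqrtr (ltW b0)) -(dilV2 G)//.
  by apply: invertible_dil; rewrite ?sqrtr_gt0.
case: (ltgtP a 0) => [a0|a0|->] Hz; last by rewrite scale0r; exact: invertible0.
  rewrite -[a *: z]opprK -scaleNr -scalerN.
  by apply: pos; rewrite ?memvN ?oppr_gt0//; exact: invertibleN.
exact: pos.
Qed.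

Lemma invertible_V3Z (a : R) z : z \in V3 -> unitS z -> unitS (a *: z).
Proof.
move=> Vz; have pos b w : w \in V3 -> 0 < b -> unitS w -> unitS (b *: w).
  by move=> Vw b0 [Sw Snw]; split; rewrite -?scalerN; apply: S_V3Z; rewrite ?memvN.
case: (ltgtP a 0) => [a0|a0|->] Hz; last by rewrite scale0r; exact: invertible0.
  rewrite -[a *: z]opprK -scaleNr -scalerN.
  by apply: pos; rewrite ?memvN ?oppr_gt0//; exact: invertibleN.
exact: pos.
Qed.

Lemma invertible_V3D x z : z \in V3 -> unitS x -> unitS z -> unitS (x + z).
Proof. by move=> Vz Hx Hz; rewrite -bch3_V3//; exact: invertible_bch. Qed.

Lemma invertible_V2D x y : x \in V2 -> y \in V2 -> unitS x -> unitS y -> unitS (x + y).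
Proof. by move=> Vx Vy Hx Hy; rewrite -bch3_V2//; exact: invertible_bch. Qed.

Lemma invertible_commutator x y : unitS x -> unitS y ->
  unitS (lie x y + 2^-1 *: lie x (lie x y) + 2^-1 *: lie y (lie x y)).
Proof.
move=> Hx Hy; rewrite -bch3_commutator; last exact: (lie4_eq0 G).
by apply: invertible_bch; apply: invertible_bch => //; exact: invertibleN.
Qed.

(** The commutator of [u] and [x + z] has no correction terms. The summand [z] is allowed so that
    [x] need be known only modulo [V3]. *)
Lemma invertible_lie12 u x z : u \in V1 -> x \in V2 -> z \in V3 ->
  unitS u -> unitS (x + z) -> unitS (lie u x).
Proof.
move=> Vu Vx Vz Hu Hxz; have := invertible_commutator Hu Hxz.
rewrite lieDr (lie_V3 G u Vz) addr0.
by rewrite !(lie_V3 G _ (lie12 G Vu Vx)) !scaler0 !addr0.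
Qed.

Lemma invertible_lieUUU u v w :
  u \in U -> v \in U -> w \in U -> unitS (lie u (lie v w)).
Proof.
move=> Uu Uv Uw.
have := invertible_commutator (invertible_U Uv) (invertible_U Uw).
rewrite -addrA.
have Vvw := lie11 G (UV Uv) (UV Uw).
apply: (invertible_lie12 (UV Uu) Vvw _ (invertible_U Uu)).
by rewrite memvD// memvZ// (lie12 G)// UV.
Qed.

(** The group commutator of [u] and [v] differs from [lie u v] by multiples of triple brackets of
    elements of [U], which are already invertible and can be cancelled. *)
Lemma invertible_lieUU u v : u \in U -> v \in U -> unitS (lie u v).
Proof.
move=> Uu Uv; have Hc := invertible_commutator (invertible_U Uu) (invertible_U Uv).
set c2 := 2^-1 *: _ in Hc; set c3 := 2^-1 *: _ in Hc.
have Vuv := lie11 G (UV Uu) (UV Uv).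
have V2' : c2 \in V3 by rewrite memvZ// (lie12 G)// UV.
have V3' : c3 \in V3 by rewrite memvZ// (lie12 G)// UV.
have -> : lie u v = lie u v + c2 + c3 + - c3 + - c2 by rewrite !addrK.
apply: invertible_V3D; rewrite ?memvN//; first apply: invertible_V3D; rewrite ?memvN//.
  apply: invertibleN; apply: invertible_V3Z; last exact: invertible_lieUUU.
  by rewrite (lie12 G)// UV.
apply: invertibleN; apply: invertible_V3Z; last exact: invertible_lieUUU.
by rewrite (lie12 G)// UV.
Qed.

Lemma S_conj x y : unitS x -> S y -> S (y + lie x y + 2^-1 *: lie x (lie x y)).
Proof.
move=> [Sx Snx] Sy; rewrite -bch3_conj; last exact: (lie4_eq0 G).
by apply: S_bch => //; exact: S_bch.
Qed.

(* Conjugate [X] by [exp (e ^- 3 v)] and dilate by [e]: as [e] tends to 0, only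
   the bracket remains. The next two lemmas follow the same scheme. *)
Lemma invertible_lieV2X v : v \in V2 -> unitS v -> unitS (lie v X).
Proof.
move=> Vv Hv; have Vl : lie v X \in V3 by exact: (lie21 G).
have pos w : w \in V2 -> unitS w -> S (lie w X).
  move=> Vw Hw; have Vl' : lie w X \in V3 by exact: (lie21 G).
  apply: (@S_lim 0 X) => e e0; rewrite scaler0 addr0.
  have := S_conj (invertible_V2Z (e ^- 3) Vw Hw) S_X.
  rewrite lieZl !lieZr (lie_V3 G _ Vl') !scaler0 addr0 => /(S_dil e0).
  rewrite dilD dilZ (dilV1 G)// (dilV3 G)// scalerA mulVf ?scale1r ?expf_neq0 ?gt_eqF//.
  by rewrite addrC.
split; first exact: pos.
by rewrite -lieNl; apply: pos; rewrite ?memvN//; exact: invertibleN.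
Qed.

Lemma S_lieUUX u : u \in U -> S (lie u (lie u X)).
Proof.
move=> Uu; set q := lie u _.
have V2l : lie u X \in V2 by apply: (lie11 G) => //; exact: UV.
have V3q : q \in V3 by apply: (lie12 G) => //; exact: UV.
(* The limit below yields only half of [q]. *)
have -> : q = 2 *: (2^-1 *: q) by rewrite scalerA mulfV ?scale1r// pnatr_eq0.
apply: S_V3Z; rewrite ?memvZ//.
(* Conjugating [X] by [e ^- 3 *: u] and dilating by [e ^+ 2] leaves powers 2, 1 and 0 of [e] in the
   three layers. *)
apply: (@S_lim X (lie u X)) => e e0.
have := S_conj (invertible_U (memvZ (e ^- 3) Uu)) S_X.
rewrite !(lieZl, lieZr) -/q => /(S_dil (exprn_gt0 2 e0)).
rewrite !(dilD, dilZ) (dilV1 G)// (dilV2 G)// (dilV3 G)//.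
congr S; rewrite !scalerA.
have e_neq0 : e != 0 by rewrite gt_eqF.
by vfield.
Qed.

Lemma invertible_lieUX u : u \in U -> unitS (lie u (lie u X)) -> unitS (lie u X).
Proof.
move=> Uu; set q := lie u _ => Hq.
have V2l : lie u X \in V2 by apply: (lie11 G) => //; exact: UV.
have V3q : q \in V3 by apply: (lie12 G) => //; exact: UV.
(* The parameter [t] takes both signs, so this gives [lie u X] and its inverse together. *)
have St (t : R) : S (t *: lie u X).
  apply: (@S_lim 0 X) => e e0; rewrite scaler0 addr0.
  have e_neq0 : e != 0 by rewrite gt_eqF.
  have := S_conj (invertible_U (memvZ (e ^- 2 * t) Uu)) S_X.
  rewrite !(lieZl, lieZr) -/q scalerA => Sc.
  (* This factor cancels the [V3] part of the conjugate, which would be of order [e ^- 1] after the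
     dilation. *)
  have [Sq _] := invertible_V3Z (- (2^-1 * (e ^- 2 * t * (e ^- 2 * t)))) V3q Hq.
  have := S_dil e0 (S_bch Sc Sq); rewrite bch3_V3 ?memvZ//.
  rewrite !(dilD, dilZ) (dilV1 G)// (dilV2 G)// (dilV3 G)//.
  by congr S; rewrite !scalerA; vfield.
by split; [rewrite -[lie u X]scale1r|rewrite -scaleN1r].
Qed.

(** As [V1] is spanned by [X] and [U], the layer [V2] is spanned by the [lie u X] and [lie u u'],
    and [V3] by brackets of [V2] with [X] and [U]; all of these are invertible. Commutators have no
    [V1] part. *)
Lemma commutator_subgroup_sub :
  (forall u, u \in U -> unitS (lie u (lie u X))) ->
  commutator_subgroup `<=` S.
Proof.
move=> Hq.
have HUX u : u \in U -> unitS (lie u X).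
  by move=> Uu; apply: invertible_lieUX => //; exact: Hq.
have V2Z a x : x \in V2 /\ unitS x -> a *: x \in V2 /\ unitS (a *: x).
  by move=> [Vx Hx]; split; [exact: memvZ|exact: invertible_V2Z].
have V2D x y : x \in V2 /\ unitS x -> y \in V2 /\ unitS y ->
    x + y \in V2 /\ unitS (x + y).
  by move=> [Vx Hx] [Vy Hy]; split; [exact: memvD|exact: invertible_V2D].
have HV2 x : x \in V2 -> x \in V2 /\ unitS x.
  rewrite -{1}(grading3_lie11 G); move: x; apply: liev_ind => //.
    by split; [exact: mem0v|exact: invertible0].
  move=> v w Vv Vw; have [a [u [Uu ->]]] := V1E Vv.
  have [b [u' [Uu' ->]]] := V1E Vw.
  have -> : lie (a *: X + u) (b *: X + u') =
      b *: lie u X + (- a) *: lie u' X + lie u u'.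
    by rewrite !(lieDl, lieDr, lieZl, lieZr) liexx (lieC X u'); vring.
  apply: (V2D); first apply: (V2D).
  - by apply: V2Z; split; [exact: (lie11 G (UV Uu))|exact: HUX].
  - by apply: V2Z; split; [exact: (lie11 G (UV Uu'))|exact: HUX].
  - by split; [exact: (lie11 G (UV Uu) (UV Uu'))|exact: invertible_lieUU].
have V3D x y : x \in V3 /\ unitS x -> y \in V3 /\ unitS y ->
    x + y \in V3 /\ unitS (x + y).
  by move=> [Vx Hx] [Vy Hy]; split; [exact: memvD|exact: invertible_V3D].
have V3Z a x : x \in V3 /\ unitS x -> a *: x \in V3 /\ unitS (a *: x).
  by move=> [Vx Hx]; split; [exact: memvZ|exact: invertible_V3Z].
have HV3 x : x \in V3 -> x \in V3 /\ unitS x.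
  rewrite -{1}(grading3_lie12 G); move: x; apply: liev_ind => //.
    by split; [exact: mem0v|exact: invertible0].
  move=> v w Vv Vw; have [a [u [Uu ->]]] := V1E Vv.
  have -> : lie (a *: X + u) w = (- a) *: lie w X + lie u w.
    by rewrite lieDl lieZl (lieC X w); vring.
  have [_ Hw] := HV2 _ Vw.
  apply: V3D.
  - by apply: V3Z; split; [exact: (lie21 G)|exact: invertible_lieV2X].
  - split; first exact: (lie12 G (UV Uu)).
    by apply: (invertible_lie12 (UV Uu) Vw (mem0v _) (invertible_U Uu)); rewrite addr0.
move=> x /pr1_commutator_subgroup x1; rewrite (pr_sum G x) x1 add0r.
have [_ H2] := HV2 (pr2 x) (memv_pr2 x); have [V3x H3] := HV3 (pr3 x) (memv_pr3 x).
by have [] := invertible_V3D V3x H2 H3.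
Qed.

(** On [V3] the product is addition, so [S] meets it in a closed convex cone. Its preimage under
    [pr3] is a cone in all of [g], to which [dual_cone_face] applies. *)
Lemma semigroup_functional :
  exists2 mu : {scalar g}, (forall z, z \in V3 -> S z -> 0 <= mu z) &
    forall z, z \in V3 -> S z -> mu z = 0 -> unitS z.
Proof.
have [|||a y a0|mu mu0 muN] := @dual_cone_face _ _ [set x | S (pr3 x)].
- apply: (@lie_closed_preimage _ _ pr3 S) => //.
  exact: (lie_continuous_linear lie_continuous_vecof).
- by rewrite /= linear0; case: invertible0.
- move=> y z /= Sy Sz; rewrite linearD /= -bch3_V3 ?memv_pr3//.
  exact: S_bch.
- by rewrite /= linearZ /=; apply: S_V3Z; rewrite ?memv_pr3.
have prK z : z \in V3 -> pr3 z = z by move=> /(prV3 G)[].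
exists mu => z Vz Sz; first by apply: mu0; rewrite /= prK.
move=> z0; split=> //; have := muN z; rewrite /= linearN /= prK//.
exact.
Qed.

End HorizontalSemigroup.

End HalfSpaceSemigroup.

Arguments horizontal_semigroup {R g} V1 V2 V3 U X S.

(** * Engel-type quotients from positive semidefinite forms *)

Section PositiveForms.
Context {R : rcfType} {vT : vectType R}.
Variables (U : {vspace vT}) (b : vT -> vT -> R).
Hypothesis bDl : forall x y z, b (x + y) z = b x z + b y z.
Hypothesis bZl : forall a x z, b (a *: x) z = a * b x z.
Hypothesis bDr : forall x y z, b z (x + y) = b z x + b z y.
Hypothesis bZr : forall a x z, b z (a *: x) = a * b z x.
Hypothesis bC : forall u w, u \in U -> w \in U -> b u w = b w u.
Hypothesis b_ge0 : forall u, u \in U -> 0 <= b u u.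

Let b0l z : b 0 z = 0. Proof. by rewrite -(scale0r 0) bZl mul0r. Qed.

Let b_suml I (r : seq I) (F : I -> vT) z :
  b (\sum_(i <- r) F i) z = \sum_(i <- r) b (F i) z.
Proof. by apply: (big_morph (b^~ z)) => [x y|]; [exact: bDl|exact: b0l]. Qed.

(** The degenerate case of Cauchy-Schwarz: [b] at [t *: u + w] is affine in [t] and nonnegative, so
    its slope vanishes. A nonzero slope would allow the value -1. *)
Let isotropic u w : u \in U -> w \in U -> b u u = 0 -> b u w = 0.
Proof.
move=> Uu Uw u0.
have key (t : R) : 0 <= 2 * t * b u w + b w w.
  have := b_ge0 (memvD (memvZ t Uu) Uw).
  by rewrite !bDl !bDr !bZl !bZr u0 (bC Uw Uu); lra.
have [//|uw] := eqVneq (b u w) 0.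
have := key (- (b w w + 1) / (2 * b u w)).
have -> : 2 * (- (b w w + 1) / (2 * b u w)) * b u w = - (b w w + 1) by field.
lra.
Qed.

Let orthonormal n (Y : 'I_n -> vT) :=
  (forall i, Y i \in U) /\ forall i j, b (Y i) (Y j) = (i == j)%:R.

Let orthonormal_dim n (Y : 'I_n -> vT) : orthonormal Y -> (n <= \dim U)%N.
Proof.
move=> [UY bY]; pose X := [tuple Y i | i < n].
have Xi (i : 'I_n) : X`_i = Y i by rewrite -tnth_nth tnth_mktuple.
have freeX : free X.
  apply/freeP => k k0 i.
  have := b0l (Y i); rewrite -k0 b_suml (bigD1 i)//= big1 => [|j ji].
    by rewrite Xi bZl bY eqxx mulr1 addr0.
  by rewrite Xi bZl bY (negPf ji) mulr0.
rewrite -(size_tuple X) -(eqP (freeX : \dim _ == _)).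
apply: dimvS; apply/span_subvP => x /tnthP[i ->].
by rewrite tnth_mktuple.
Qed.

(** Gram-Schmidt for a possibly degenerate form. If the last identity failed for every orthonormal
    family, each could be extended by a normalized residual, beyond the dimension of [U]. *)
Lemma psd_orthonormal : exists n (Y : 'I_n -> vT),
  [/\ forall i, Y i \in U, forall i j, b (Y i) (Y j) = (i == j)%:R &
    forall u w, u \in U -> w \in U -> b u w = \sum_i b u (Y i) * b (Y i) w].
Proof.
apply: contrapT => nY.
have ext k : exists Y : 'I_k -> vT, orthonormal Y.
  elim: k => [|k [Y [UY bY]]]; first by exists (fun=> 0); split=> -[].
  have [u [Uu u0]] : exists u, u \in U /\
      let v := u - \sum_i b u (Y i) *: Y i in b v v != 0.
    (* If all residuals are isotropic, they lie in the radical, which is the last identity. *)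
    apply: contrapT => nu; apply: nY; exists k, Y; split=> // u w Uu Uw.
    pose v := u - \sum_i b u (Y i) *: Y i.
    have Uv : v \in U by rewrite rpredB// memv_suml// => i _; exact: memvZ.
    have v0 : b v v = 0.
      by apply/eqP; apply: contrapT => /negP v0; apply: nu; exists u.
    have := isotropic Uv Uw v0; rewrite /v -scaleN1r bDl bZl mulN1r b_suml.
    move=> /eqP; rewrite subr_eq0 => /eqP ->.
    by apply: eq_bigr => i _; rewrite bZl.
  pose v := u - \sum_i b u (Y i) *: Y i.
  have Uv : v \in U by rewrite rpredB// memv_suml// => i _; exact: memvZ.
  have vY i : b v (Y i) = 0.
    rewrite /v -scaleN1r bDl bZl mulN1r b_suml (bigD1 i)//= big1 => [|j ji].
      by rewrite bZl bY eqxx mulr1 addr0 subrr.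
    by rewrite bZl bY (negPf ji) mulr0.
  have vv : 0 < b v v by rewrite lt_def u0 b_ge0.
  pose y := (Num.sqrt (b v v))^-1 *: v.
  have yy : b y y = 1.
    by rewrite bZl bZr mulrA -invfM -expr2 (sqr_sqrtr (ltW vv)) mulVf// gt_eqF.
  have yY i : b y (Y i) = 0 by rewrite bZl vY mulr0.
  exists (fun i => if unlift ord0 i is Some j then Y j else y); split=> [i|i j].
    by case: unliftP => // _; exact: memvZ.
  case: unliftP => [i' ->|->]; case: unliftP => [j' ->|->].
  - by rewrite bY (inj_eq (@lift_inj _ _)).
  - by rewrite bC ?memvZ// yY eq_sym (negPf (neq_lift _ _)).
  - by rewrite yY (negPf (neq_lift _ _)).
  - by rewrite yy eqxx.
by have [Y /orthonormal_dim] := ext (\dim U).+1; rewrite ltnn.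
Qed.

End PositiveForms.

Section EngelQuotient.
Context {R : realType} {g : vectLieAlgType R} {V1 V2 V3 : {vspace g}}.
Hypothesis G : grading3 V1 V2 V3.
Implicit Types x y z u v w : g.

Local Notation pr1 := (pr1 V1 V2 V3).
Local Notation pr2 := (pr2 V1 V2 V3).
Local Notation pr3 := (pr3 V1 V2 V3).

(** The first isomorphism theorem; the third hypothesis makes the kernel homogeneous. *)
Lemma engel_quotient_of_morphism n (f : {linear g -> engel R n}) :
  (forall x y, f (lie x y) = lie (f x) (f y)) ->
  (forall e, exists x, f x = e) ->
  (forall x, f x = 0 -> [/\ f (pr1 x) = 0, f (pr2 x) = 0 & f (pr3 x) = 0]) ->
  exists2 I : lieIdeal g,
    (ideal_vspace I = (I :&: V1) + ((I :&: V2) + (I :&: V3)))%VS &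
    lie_isomorphic (lie_quot I) (engel R n).
Proof.
move=> flie fsurj fgr.
pose D : {vspace g} := lker (linfun f).
have DE x : (x \in D) = (f x == 0) by rewrite memv_ker lfunE.
have Dlie x y : y \in D -> lie x y \in D.
  by rewrite !DE flie => /eqP ->; rewrite lie0r.
pose I := LieIdeal Dlie; exists I.
  apply/eqP; rewrite eqEsubv; apply/andP; split.
    apply/subvP => x; rewrite /= DE => /eqP /fgr[f1 f2 f3].
    rewrite (pr_sum G x) -addrA; apply: memv_add; last apply: memv_add.
    - by rewrite memv_cap DE f1 eqxx memv_pr1.
    - by rewrite memv_cap DE f2 eqxx memv_pr2.
    - by rewrite memv_cap DE f3 eqxx memv_pr3.
  by rewrite !subv_add !capvSl.
pose pi x : lie_quot I := \pi_(lie_quot I)%qT x.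
have piP (p : lie_quot I) : exists x, p = pi x.
  by exists (repr p); rewrite /pi reprK.
have freprE x : f (repr (pi x)) = f x.
  apply/eqP; rewrite -subr_eq0 -linearB -DE; exact: (@quot_reprB _ _ I).
have piL a x y : a *: pi x + pi y = pi (a *: x + y).
  by rewrite /pi quotD; congr (_ + _); exact: quot_scaleE.
pose h0 (p : lie_quot I) : engel R n := f (repr p).
have lin : linear h0.
  move=> a p q; have [x ->] := piP p; have [y ->] := piP q.
  by rewrite piL /h0 !freprE linearP.
pose h : {linear lie_quot I -> engel R n} :=
  HB.pack h0 (GRing.isLinear.Build _ _ _ _ _ lin).
have hE x : h (pi x) = f x by exact: freprE.
exists h; last first.
  move=> p q; have [x ->] := piP p; have [y ->] := piP q.
  have -> : lie (pi x) (pi y) = pi (lie x y) by exact: quot_lieE.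
  by rewrite !hE flie.
exists (fun e => pi (projT1 (cid (fsurj e)))).
  move=> p; have [x ->] := piP p; rewrite hE; case: cid => y fy.
  by apply/eqP; rewrite /pi quot_eq DE linearB /= fy subrr.
by move=> e; case: cid => y fy; rewrite hE.
Qed.

Variables (U : {vspace g}) (X : g) (L mu : {scalar g}).
Hypothesis V1X : X \in V1.
Hypothesis subUV : (U <= V1)%VS.
Hypothesis V1E : forall v, v \in V1 -> exists (a : R) (u : g), u \in U /\ v = a *: X + u.
Hypothesis LX : L X = 1.
Hypothesis LU : forall u, u \in U -> L u = 0.
Hypothesis mu_UUU : forall u v w, u \in U -> v \in U -> w \in U ->
  mu (lie u (lie v w)) = 0.
Hypothesis mu_XUU : forall u v, u \in U -> v \in U -> mu (lie X (lie u v)) = 0.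

Let UV u : u \in U -> u \in V1. Proof. by move=> Uu; exact: (subvP subUV). Qed.

Local Notation beta u w := (mu (lie u (lie w X))).

Let muD x y : mu (x + y) = mu x + mu y. Proof. exact: linearD. Qed.
Let muZ a x : mu (a *: x) = a * mu x. Proof. exact: linearZ. Qed.
Let mu_sum I (r : seq I) (F : I -> g) :
  mu (\sum_(i <- r) F i) = \sum_(i <- r) mu (F i).
Proof. exact: linear_sum. Qed.

(** By Jacobi, the antisymmetric part is [mu] of a bracket of [X] with [lie u w]. *)
Lemma betaC u w : u \in U -> w \in U -> beta u w = beta w u.
Proof.
move=> Uu Uw; apply/eqP; rewrite -subr_eq0 -linearB /= -lie_lie lieC linearN /=.
by rewrite mu_XUU// oppr0.
Qed.

Section AdaptedBasis.
Variables (n : nat) (Y : 'I_n -> g).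
Hypothesis n_gt0 : (0 < n)%N.
Hypothesis UY : forall i, Y i \in U.
Hypothesis YY : forall i j, beta (Y i) (Y j) = (i == j)%:R.
Hypothesis betaE : forall u w, u \in U -> w \in U ->
  beta u w = \sum_i beta u (Y i) * beta (Y i) w.
Hypothesis mu_XUX : forall u, u \in U -> mu (lie X (lie u X)) = 0.

(** Orthonormality of [Y] lets brackets with [Y i], followed by [mu], serve as coordinates: [X],
    [Y i], [lie (Y i) X] and [lie (Y i) (lie (Y i) X)] go to the basis of the Engel-type algebra. *)
Definition engel_map x : engel R n :=
  (L (pr1 x) : R^o, \row_i mu (lie (Y i) (lie (pr1 x) X)),
   \row_i mu (lie (Y i) (pr2 x)), mu (pr3 x) : R^o).

Lemma engel_map_linear : linear engel_map.
Proof.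
move=> a x y; rewrite /engel_map !linearP /=.
congr (_, _, _, _).
- by apply/rowP => i; rewrite !mxE lie_linearl lie_linearr linearP.
- by apply/rowP => i; rewrite !mxE lie_linearr linearP.
Qed.

Let lieE a u b w : lie (a *: X + u) (b *: X + w) =
  b *: lie u X + (- a) *: lie w X + lie u w.
Proof. by rewrite !(lieDl, lieDr, lieZl, lieZr) liexx (lieC X w); vring. Qed.

Let mu_lieY i a u b w : u \in U -> w \in U ->
  mu (lie (Y i) (lie (a *: X + u) (b *: X + w))) =
  b * beta (Y i) u - a * beta (Y i) w.
Proof.
move=> Uu Uw; rewrite lieE !lieDr !lieZr !muD !muZ (mu_UUU (UY i) Uu Uw).
by rewrite addr0 mulNr.
Qed.

(** On [V2], bracketing with [X] is invisible to [mu], and by [betaE] bracketing with [u] is a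
    combination of bracketings with the [Y i]. This makes the last component of [engel_map] respect
    brackets. *)
Let mu_lieV2 a u z : u \in U -> z \in V2 ->
  mu (lie (a *: X + u) z) = \sum_i beta (Y i) u * mu (lie (Y i) z).
Proof.
move=> Uu; rewrite -(grading3_lie11 G); move: z; apply: liev_ind.
- rewrite lie0r linear0 big1// => i _.
  by rewrite lie0r linear0 mulr0.
- move=> x y xE yE; rewrite lieDr muD xE yE -big_split; apply: eq_bigr => i _.
  by rewrite lieDr muD mulrDr.
- move=> c x xE; rewrite lieZr muZ xE mulr_sumr; apply: eq_bigr => i _.
  by rewrite lieZr muZ mulrCA.
- move=> v w /V1E[c [p [Up ->]]] /V1E[d [q [Uq ->]]].
  rewrite (eq_bigr (fun i => d * (beta u (Y i) * beta (Y i) p)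
      + - c * (beta u (Y i) * beta (Y i) q))); last first.
    by move=> i _; rewrite mu_lieY// (betaC (UY i) Uu); ring.
  rewrite big_split -!mulr_sumr -!betaE//=.
  rewrite lieE !(lieDl, lieDr, lieZl, lieZr) !(muD, muZ).
  by rewrite !mu_XUX// (mu_XUU Up Uq) (mu_UUU Uu Up Uq); ring.
Qed.

Lemma engel_map_lie x y : engel_map (lie x y) = lie (engel_map x) (engel_map y).
Proof.
rewrite /engel_map (pr1_lie G) (pr2_lie G) (pr3_lie G) [RHS]/lie /=.
have [a [u [Uu xE]]] := V1E (memv_pr1 x : pr1 x \in V1).
have [b [w [Uw yE]]] := V1E (memv_pr1 y : pr1 y \in V1).
have LE c v : v \in U -> L (c *: X + v) = c.
  by move=> Uv; rewrite linearP LX LU// addr0; exact: mulr1.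
have YE i c v : v \in U -> mu (lie (Y i) (lie (c *: X + v) X)) = beta (Y i) v.
  by move=> Uv; rewrite lieDl lieZl liexx scaler0 add0r.
congr (_, _, _, _).
- exact: linear0.
- by apply/rowP => i; rewrite !mxE lie0l lie0r linear0.
- by apply/rowP => i; rewrite !mxE xE yE mu_lieY// !YE// !LE.
- rewrite muD xE yE mu_lieV2// ?memv_pr2//.
  rewrite (lieC (pr2 x)) linearN /= mu_lieV2// ?memv_pr2// -sumrB.
  by apply: eq_bigr => i _; rewrite !mxE !YE//; ring.
Qed.

Lemma engel_map_graded x : engel_map x = 0 ->
  [/\ engel_map (pr1 x) = 0, engel_map (pr2 x) = 0 & engel_map (pr3 x) = 0].
Proof.
have [a1 a2 a3] := prV1 G (memv_pr1 x : pr1 x \in V1).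
have [b1 b2 b3] := prV2 G (memv_pr2 x : pr2 x \in V2).
have [c1 c2 c3] := prV3 G (memv_pr3 x : pr3 x \in V3).
rewrite /engel_map a1 a2 a3 b1 b2 b3 c1 c2 c3 => -[-> -> -> ->].
have r0 F : F = 0 -> (\row_(i < n) (mu (lie (Y i) F))) = 0.
  by move=> ->; apply/rowP => i; rewrite !mxE lie0r linear0.
by split; congr (_, _, _, _); rewrite ?lie0l ?r0 ?linear0.
Qed.

Lemma engel_map_surj e : exists x, engel_map x = e.
Proof.
case: e => [[[a y] t] b].
(* Any index serves to reach [engelZ]. *)
pose i0 : 'I_n := Ordinal n_gt0.
pose v1 := a *: X + \sum_i y 0 i *: Y i.
pose v2 := \sum_i t 0 i *: lie (Y i) X.
pose v3 := b *: lie (Y i0) (lie (Y i0) X).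
have UYs : \sum_i y 0 i *: Y i \in U by apply: memv_suml => i _; exact: memvZ.
have V1v : v1 \in V1 by rewrite memvD ?memvZ// UV.
have V2v : v2 \in V2 by apply: memv_suml => i _; rewrite memvZ// (lie11 G)// UV.
have V3v : v3 \in V3 by rewrite memvZ// (lie12 G)// ?(lie11 G)// UV.
have [p1 p2 p3] := pr_comb G V1v V2v V3v.
have sumE (c : 'rV[R]_n) i : \sum_j c 0 j * (i == j)%:R = c 0 i.
  rewrite (bigD1 i)//= eqxx mulr1 big1 ?addr0// => j ji.
  by rewrite eq_sym (negPf ji) mulr0.
exists (v1 + v2 + v3); rewrite /engel_map p1 p2 p3; congr (_, _, _, _).
- by rewrite linearP LX LU// addr0; exact: mulr1.
- apply/rowP => i; rewrite mxE lieDl lieZl liexx scaler0 add0r.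
  rewrite lie_suml lie_sumr mu_sum -[RHS]sumE; apply: eq_bigr => j _.
  by rewrite lieZl lieZr muZ YY.
- apply/rowP => i; rewrite mxE lie_sumr mu_sum -[RHS]sumE.
  by apply: eq_bigr => j _; rewrite lieZr muZ YY.
- by rewrite /v3 muZ YY eqxx mulr1.
Qed.

Lemma adapted_engel_quotient : exists2 I : lieIdeal g,
    (ideal_vspace I = (I :&: V1) + ((I :&: V2) + (I :&: V3)))%VS &
    lie_isomorphic (lie_quot I) (engel R n).
Proof.
pose f : {linear g -> engel R n} := HB.pack engel_map
  (GRing.isLinear.Build _ _ _ _ _ engel_map_linear).
apply: (@engel_quotient_of_morphism n f).
- exact: engel_map_lie.
- exact: engel_map_surj.
- exact: engel_map_graded.
Qed.

End AdaptedBasis.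

End EngelQuotient.

(** * Engel-type quotients from half-spaces that are not semigenerating *)

Section NotSemigenerated.
Context {R : realType} {g : vectLieAlgType R} {V1 V2 V3 : {vspace g}}.
Hypothesis G : grading3 V1 V2 V3.
Implicit Types x y z u v w : g.

Lemma not_semigenerating_engel_quotient (W : set g) :
  horizontal_half_space V1 W -> ~ semigenerating W ->
  exists n : nat, (1 <= n)%N /\ exists2 I : lieIdeal g,
    (ideal_vspace I = (I :&: V1) + ((I :&: V2) + (I :&: V3)))%VS &
    lie_isomorphic (lie_quot I) (engel R n).
Proof.
move=> [l l0 WE] nsg.
(* The form [l] lives on the subspace type of [V1]; the projection extends it to [g]. *)
have Lscalar : scalar (fun v => l (vsproj V1 v) : R).
  by move=> a x y; rewrite !linearP.
have [L Lval] : exists L : {scalar g}, forall p, L (vsval p) = l p.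
  pose L : {scalar g} := HB.pack (fun v => l (vsproj V1 v) : R)
    (GRing.isLinear.Build _ _ _ _ _ Lscalar).
  by exists L => p; rewrite /L /= vsvalK.
have WP v : W v <-> v \in V1 /\ 0 <= L v.
  rewrite WE; split=> [[p /= lp <-]|[Vv Lv]].
    by split; [exact: subvsP|rewrite Lval].
  exists (vsproj V1 v); last exact: vsprojK.
  by rewrite /= -Lval vsprojK.
have [X V1X LX] : exists2 X, X \in V1 & L X = 1.
  have [p lp] : exists p, l p != 0.
    apply: contrapT => nl; move/eqP: l0; apply; apply/lfunP => p; rewrite lfunE /=.
    by apply/eqP; apply: contrapT => /negP lp; apply: nl; exists p.
  exists ((l p)^-1 *: vsval p); first by rewrite memvZ// subvsP.
  by rewrite linearZ Lval; exact: mulVf.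
pose Lo : {linear g -> R^o} := L.
pose U := (V1 :&: lker (linfun Lo))%VS.
have UE u : (u \in U) = (u \in V1) && (L u == 0).
  by rewrite memv_cap memv_ker lfunE.
have subUV : (U <= V1)%VS by exact: capvSl.
have UV u : u \in U -> u \in V1 by exact: (subvP subUV).
have LU u : u \in U -> L u = 0 by rewrite UE => /andP[_ /eqP].
have V1E v : v \in V1 -> exists (a : R) u, u \in U /\ v = a *: X + u.
  move=> Vv; exists (L v), (v - L v *: X); split; last by rewrite addrC subrK.
  by rewrite UE memvB ?memvZ// linearB linearZ /= LX mulr1 subrr eqxx.
pose S := lie_closure (semigroup_gen W).
have HS : horizontal_semigroup V1 V2 V3 U X S.
  split.
  - exact: V1X.
  - exact: subUV.
  - exact: V1E.
  - exact: lie_closed_closure.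
  - exact: closure_semigroup_bch3.
  - apply: (closure_semigroup_dil G) => [v /WP[]//|a v a0 /WP[Vv Lv]].
    by apply/WP; rewrite memvZ// linearZ /= mulr_ge0// ltW.
  - move=> u Uu; apply: sub_lie_closure; apply: semigroup_gen_in; apply/WP.
    by rewrite UV// LU.
  - by apply: sub_lie_closure; apply: semigroup_gen_in; apply/WP; rewrite LX.
have nsub : ~ (commutator_subgroup `<=` S) := nsg.
(* From here on [S] is known only through [HS] and [nsub]. *)
move: S HS nsub => S HS nsub.
have [mu mu_ge0 mu_invertible] := semigroup_functional G HS.
have mu0 z : z \in V3 -> invertible_in S z -> mu z = 0.
  move=> Vz [Sz Snz]; have := mu_ge0 _ Vz Sz.
  by have := mu_ge0 (- z); rewrite memvN linearN /= => /(_ Vz Snz); lra.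
have mu_UUU u v w : u \in U -> v \in U -> w \in U -> mu (lie u (lie v w)) = 0.
  move=> Uu Uv Uw; apply: mu0; first by rewrite (lie12 G) ?(lie11 G)// UV.
  exact: (invertible_lieUUU G HS).
have mu_XUU u v : u \in U -> v \in U -> mu (lie X (lie u v)) = 0.
  move=> Uu Uv; have Vuv : lie u v \in V2 by rewrite (lie11 G)// UV.
  apply/eqP; rewrite lieC linearN oppr_eq0; apply/eqP.
  apply: mu0; first exact: (lie21 G).
  apply: (invertible_lieV2X G HS Vuv).
  exact: (invertible_lieUU G HS).
pose beta u w := mu (lie u (lie w X)).
have bC := betaC mu_XUU.
have [||||||n [Y [UY YY YE]]] := @psd_orthonormal _ _ U beta.
- by move=> x y z; rewrite /beta lieDl linearD.
- by move=> a x z; rewrite /beta lieZl linearZ.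
- by move=> x y z; rewrite /beta lieDl lieDr linearD.
- by move=> a x z; rewrite /beta lieZl lieZr linearZ.
- exact: bC.
- move=> u Uu; apply: mu_ge0; first by rewrite (lie12 G) ?(lie11 G)// UV.
  exact: (S_lieUUX G HS).
have invertible_q u : u \in U -> beta u u = 0 ->
    invertible_in S (lie u (lie u X)).
  move=> Uu; apply: mu_invertible; first by rewrite (lie12 G) ?(lie11 G)// UV.
  exact: (S_lieUUX G HS).
(* An empty family means that [beta] vanishes on [U]; then every [lie u (lie u X)] is invertible and
   [S] contains the commutator subgroup. *)
have n_gt0 : (0 < n)%N.
  rewrite lt0n; apply/eqP => n0; subst n; apply: nsub.
  apply: (commutator_subgroup_sub G HS).
  by move=> u Uu; apply: invertible_q => //; rewrite YE// big_ord0.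
exists n; split=> //.
pose m u := mu (lie X (lie u X)).
(* Invertibility passes from [lie u (lie u X)] to [lie u X] and then to its bracket with [X]. *)
have m_isotropic u : u \in U -> beta u u = 0 -> m u = 0.
  move=> Uu bu; have Vu : lie u X \in V2 by rewrite (lie11 G)// UV.
  apply/eqP; rewrite /m lieC linearN oppr_eq0; apply/eqP.
  apply: mu0; first exact: (lie21 G).
  apply: (invertible_lieV2X G HS Vu).
  apply: (invertible_lieUX G HS Uu).
  exact: invertible_q.
(* The residual [u - p] is isotropic, so [m] is determined by its values on [Y]. *)
have mE u : u \in U -> m u = \sum_i beta u (Y i) * m (Y i).
  move=> Uu; pose p := \sum_i beta u (Y i) *: Y i.
  have Up : p \in U by apply: memv_suml => i _; exact: memvZ.
  have Uup : u - p \in U by exact: memvB.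
  have : m (u - p) = 0.
    apply: m_isotropic => //.
    have bp w : beta p w = \sum_i beta u (Y i) * beta (Y i) w.
      rewrite /beta /p lie_suml linear_sum; apply: eq_bigr => i _.
      by rewrite lieZl linearZ.
    have -> : beta (u - p) (u - p) = beta u (u - p) - beta p (u - p).
      by rewrite [in LHS]/beta lieDl linearD lieNl linearN.
    by rewrite YE// bp subrr.
  rewrite /m lieDl lieDr linearD lieNl lieNr linearN /= => /eqP.
  rewrite subr_eq0 => /eqP ->; rewrite lie_suml lie_sumr linear_sum.
  by apply: eq_bigr => i _; rewrite lieZl lieZr linearZ.
(* The correction [u0] of [X] makes [mu [X', [u, X']]] vanish on [U]. *)
pose u0 := - \sum_i m (Y i) *: Y i.
have Uu0 : u0 \in U by rewrite memvN memv_suml// => i _; exact: memvZ.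
have bu0 u : u \in U -> beta u0 u = - m u.
  move=> Uu; rewrite mE// /beta /u0 lieNl linearN /=; congr (- _).
  rewrite lie_suml linear_sum; apply: eq_bigr => i _.
  by rewrite lieZl linearZ /= mulrC -/(beta _ _) [beta _ _]bC.
pose X' := X + u0.
(* Replacing [X] by [X'] does not change the form, because [mu] kills triple brackets in [U]. *)
have bE u w : u \in U -> w \in U -> mu (lie u (lie w X')) = beta u w.
  by move=> Uu Uw; rewrite /X' !lieDr linearD /= (mu_UUU u w u0)// addr0.
apply: (@adapted_engel_quotient _ _ _ _ _ G U X' L mu _ subUV _ _ _ _ _ n Y) => //.
- by rewrite memvD// UV.
- move=> v /V1E[a [u [Uu ->]]]; exists a, (u - a *: u0); split.
    by rewrite memvB ?memvZ.
  by rewrite /X'; vring.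
- by rewrite linearD /= LX LU// addr0.
- by move=> u v Uu Uv; rewrite lieDl linearD /= mu_XUU// mu_UUU// addr0.
- by move=> i j; rewrite bE.
- move=> u w Uu Uw; rewrite bE// YE//; apply: eq_bigr => i _.
  by rewrite !bE.
- move=> u Uu; rewrite /X' !lieDr !lieDl !linearD /= (mu_UUU u0 u u0)//.
  rewrite (mu_XUU u u0)// -/(m u) -/(beta u0 u) bu0//.
  by ring.
Qed.

End NotSemigenerated.

(** * Algebras with an Engel-type quotient are not semigenerated *)

Section EngelMonotone.
Context {R : realType} {n : nat}.
Implicit Types (u v : engel R n) (z : 'rV[R]_n).

(* If a horizontal curve with [x' = a >= 0] goes from the identity to [u], this
   is the integral of [|y - z|^2] against [dx] along the curve; whence the
   cocycle rule [engel_cost_bch3] and the nonnegativity on products of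
   exponentials from the half-space. *)
Definition engel_cost u z : R :=
  let: (a, y, t, b) := u in
  2 * b + \sum_i (y 0 i * t 0 i + 3^-1 * (a * y 0 i ^+ 2) - 2 * (z 0 i * t 0 i)
    - a * (z 0 i * y 0 i) + a * z 0 i ^+ 2).

Lemma engel_bch3E (a a' b b' : R^o) (y y' t t' : 'rV[R]_n) :
  bch3 ((a, y, t, b) : engel R n) (a', y', t', b') =
  (a + a', y + y', t + t' + 2^-1 *: (a' *: y - a *: y'),
   b + b' + \sum_i (2^-1 * (y 0 i * t' 0 i - t 0 i * y' 0 i)
     + 12^-1 * (y 0 i * (a' * y 0 i - a * y' 0 i)
                + y' 0 i * (a * y' 0 i - a' * y 0 i)))).
Proof.
rewrite /bch3 /lie /=; congr (_, _, _, _) => /=.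
- by rewrite addr0 /GRing.scale /= !mulr0 !addr0.
- by rewrite addr0 !scaler0 !addr0.
- by rewrite !scaler0 !scale0r !subrr addr0 scaler0 addr0.
- rewrite /GRing.scale /= -big_split !mulr_sumr -addrA -big_split; congr (_ + _).
  by apply: eq_bigr => i _; rewrite !mxE /=; ring.
Qed.

Lemma engel_cost_bch3 u v z :
  engel_cost (bch3 u v) z = engel_cost u z + engel_cost v (z - u.1.1.2).
Proof.
case: u => [[[a y] t] b]; case: v => [[[a' y'] t'] b'].
rewrite engel_bch3E /engel_cost /=.
rewrite mulrDr mulr_sumr -addrA -big_split addrACA -big_split -mulrDr.
congr (_ + _); apply: eq_bigr => i _; rewrite !mxE /=.
by field.
Qed.

Lemma engel_cost_horizontal (a : R) (y : 'rV[R]_n) z :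
  0 <= a -> 0 <= engel_cost (a, y, 0, 0) z.
Proof.
move=> a0; rewrite /engel_cost mulr0 add0r; apply: sumr_ge0 => i _.
(* Completing the square in the integral of [a * (s * y - z) ^+ 2] over [s] from 0 to 1; [12^-1] is
   the variance of the uniform distribution. *)
rewrite !mxE; have -> : y 0 i * 0 + 3^-1 * (a * y 0 i ^+ 2) - 2 * (z 0 i * 0)
    - a * (z 0 i * y 0 i) + a * z 0 i ^+ 2 =
  a * ((z 0 i - 2^-1 * y 0 i) ^+ 2 + 12^-1 * y 0 i ^+ 2) by field.
by rewrite mulr_ge0// addr_ge0 ?sqr_ge0// mulr_ge0 ?sqr_ge0// invr_ge0.
Qed.

End EngelMonotone.

Section EngelQuotientObstruction.
Context {R : realType} {g : vectLieAlgType R} {V1 V2 V3 : {vspace g}}.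
Hypothesis G : grading3 V1 V2 V3.
Variables (n : nat) (f : {linear g -> engel R n}).
Hypothesis n_gt0 : (0 < n)%N.
Hypothesis f_lie : forall x y, f (lie x y) = lie (f x) (f y).
Hypothesis f_surj : forall e, exists x, f x = e.
Implicit Types x y z u v w : g.

Local Notation pr1 := (pr1 V1 V2 V3).
Local Notation pr2 := (pr2 V1 V2 V3).
Local Notation pr3 := (pr3 V1 V2 V3).

Let f_V2 x : x \in V2 -> (f x).1.1 = 0.
Proof.
rewrite -(grading3_lie11 G); move: x; apply: liev_ind.
- by rewrite linear0.
- by move=> x y x0 y0; rewrite linearD /= x0 y0 addr0.
- by move=> a x x0; rewrite linearZ /= x0 scaler0.
- move=> u w _ _; rewrite f_lie.
  by case: (f u) => [[[? ?] ?] ?]; case: (f w) => [[[? ?] ?] ?].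
Qed.

Let f_V3 x : x \in V3 -> (f x).1 = 0.
Proof.
rewrite -(grading3_lie12 G); move: x; apply: liev_ind.
- by rewrite linear0.
- by move=> x y x0 y0; rewrite linearD /= x0 y0 addr0.
- by move=> a x x0; rewrite linearZ /= x0 scaler0.
- move=> u w _ /f_V2; rewrite f_lie; case: (f u) => [[[? ?] ?] ?].
  case: (f w) => [[[? ?] ?] ?] /= [-> ->]; congr (_, _, _).
  by rewrite /= scale0r scaler0 subrr.
Qed.

(* [f] need not map [V1] into the span of [X] and the [Y_i], but the graded map
   that it induces is again a morphism. *)
Definition graded_part x : engel R n :=
  ((f (pr1 x)).1.1.1, (f (pr1 x)).1.1.2, (f (pr2 x)).1.2, (f (pr3 x)).2).

Lemma graded_part_linear : linear graded_part.
Proof. by move=> a x y; rewrite /graded_part !linearP. Qed.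

Lemma graded_part_lie x y :
  graded_part (lie x y) = lie (graded_part x) (graded_part y).
Proof.
rewrite /graded_part (pr1_lie G) (pr2_lie G) (pr3_lie G) linearD !f_lie !linear0.
have := f_V2 (memv_pr2 x : pr2 x \in V2).
have := f_V2 (memv_pr2 y : pr2 y \in V2).
move: (f (pr1 x)) (f (pr1 y)) (f (pr2 x)) (f (pr2 y)).
move=> [[[a1 y1] t1] b1] [[[a2 y2] t2] b2] [[[a3 y3] t3] b3] [[[a4 y4] t4] b4] /=.
move=> [_ ->] [_ ->]; rewrite /lie /=; congr (_, _, _, _).
rewrite -big_split; apply: eq_bigr => i _ /=; rewrite !mxE.
by ring.
Qed.

Lemma graded_part_bch3 x y :
  graded_part (bch3 x y) = bch3 (graded_part x) (graded_part y).
Proof.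
have gD u v : graded_part (u + v) = graded_part u + graded_part v.
  by have := graded_part_linear 1 u v; rewrite !scale1r.
have g0 : graded_part 0 = 0 by apply: (@addrI _ (graded_part 0)); rewrite -gD !addr0.
have gZ a u : graded_part (a *: u) = a *: graded_part u.
  by have := graded_part_linear a u 0; rewrite g0 !addr0.
by rewrite /bch3 !(gD, gZ, graded_part_lie).
Qed.

Lemma graded_part_V1 x : x \in V1 ->
  graded_part x = ((f x).1.1.1, (f x).1.1.2, 0, 0).
Proof. by move=> /(prV1 G)[x1 x2 x3]; rewrite /graded_part x1 x2 x3 !linear0. Qed.

Lemma graded_part_surj1 (a : R^o) (y : 'rV[R]_n) :
  exists2 x, x \in V1 & graded_part x = (a, y, 0, 0).
Proof.
(* The higher layers do not contribute to the first two components, so the [V1] part of a preimage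
   suffices. *)
have [x fx] := f_surj (a, y, 0, 0); exists (pr1 x); first exact: memv_pr1.
rewrite graded_part_V1 ?memv_pr1//.
have : (f x).1.1 = (a, y) by rewrite fx.
rewrite {1}(pr_sum G x) !linearD /= (f_V2 (memv_pr2 x : pr2 x \in V2)).
rewrite (f_V3 (memv_pr3 x : pr3 x \in V3)) /= !addr0.
by move=> ->.
Qed.

Lemma engel_cost_closed : lie_closed [set x | 0 <= engel_cost (graded_part x) 0].
Proof.
pose T := 'rV[R]_(\dim {:g}).
have cs (phi : g -> R) : scalar phi ->
    continuous (fun p : T => phi (vecof (vbasis {:g}) p)).
  move=> phiL; pose h : {scalar g} :=
    HB.pack phi (GRing.isLinear.Build _ _ _ _ _ phiL).
  exact: (scalar_continuous (f := h) lie_continuous_vecof).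
have cD (F H : T -> R) : continuous F -> continuous H -> continuous (fun p => F p + H p).
  by move=> cF cH p; exact: (cvgD (cF p) (cH p)).
have cM (F H : T -> R) : continuous F -> continuous H -> continuous (fun p => F p * H p).
  by move=> cF cH p; exact: (cvgM (cF p) (cH p)).
have cC (a : R) : continuous (fun _ : T => a) by exact: cst_continuous.
have cA : continuous (fun p : T => (f (pr1 (vecof (vbasis {:g}) p))).1.1.1 : R).
  by apply: (cs (fun x => (f (pr1 x)).1.1.1)) => a x y; rewrite !linearP.
have cY i : continuous (fun p : T => (f (pr1 (vecof (vbasis {:g}) p))).1.1.2 0 i).
  by apply: (cs (fun x => (f (pr1 x)).1.1.2 0 i)) => a x y; rewrite !linearP /= !mxE.
have cT i : continuous (fun p : T => (f (pr2 (vecof (vbasis {:g}) p))).1.2 0 i).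
  by apply: (cs (fun x => (f (pr2 x)).1.2 0 i)) => a x y; rewrite !linearP /= !mxE.
have cB : continuous (fun p : T => (f (pr3 (vecof (vbasis {:g}) p))).2 : R).
  by apply: (cs (fun x => (f (pr3 x)).2)) => a x y; rewrite !linearP.
have cE : continuous (fun p : T => engel_cost (graded_part (vecof (vbasis {:g}) p)) 0).
  rewrite /engel_cost /graded_part; apply: (cD); first exact: cM.
  apply: continuous_big => [|i _]; first exact: add_continuous.
  (* At [z = 0] each summand is a polynomial in linear forms of [x]. *)
  rewrite (_ : (fun p => _) = (fun p : T =>
      (f (pr1 (vecof (vbasis {:g}) p))).1.1.2 0 i *
      (f (pr2 (vecof (vbasis {:g}) p))).1.2 0 i
      + 3^-1 * ((f (pr1 (vecof (vbasis {:g}) p))).1.1.1 *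
        ((f (pr1 (vecof (vbasis {:g}) p))).1.1.2 0 i *
         (f (pr1 (vecof (vbasis {:g}) p))).1.1.2 0 i)))).
    apply: (cD); first exact: cM.
    by apply: (cM) => //; apply: (cM) => //; exact: cM.
  by apply/funext => p; rewrite !mxE; ring.
rewrite /lie_closed (_ : mkset _ =
  (fun p : T => engel_cost (graded_part (vecof (vbasis {:g}) p)) 0) @^-1`
    [set r | 0 <= r])//.
by apply: preimage_closed => //; exact: closed_ge.
Qed.

Lemma not_semigenerated_of_morphism : ~ semigenerated V1.
Proof.
(* The half-space where the [engelX] coordinate is nonnegative will fail to be semigenerating. *)
pose A (p : subvs_of V1) : R^o := (graded_part (vsval p)).1.1.1.
have Alin : linear A.
  by move=> a p q; rewrite /A linearP graded_part_linear.
have [l lE] : exists l : 'Hom(subvs_of V1, R^o), forall p, l p = A p.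
  pose Al : {linear subvs_of V1 -> R^o} :=
    HB.pack A (GRing.isLinear.Build _ _ _ _ _ Alin).
  by exists (linfun Al) => p; rewrite lfunE.
have [X V1X gX] := graded_part_surj1 1 0.
have [Y V1Y gY] := graded_part_surj1 0 (delta_mx 0 (Ordinal n_gt0)).
pose W := [set vsval u | u in [set u | 0 <= l u]].
move=> /(_ W) sub.
have {}sub : semigenerating W.
  apply: sub; exists l => //; apply/eqP => l0.
  have := lE (vsproj V1 X); rewrite l0 lfunE /= /A vsprojK// gX /= => /eqP.
  by rewrite eq_sym oner_eq0.
(* All [z] are treated at once, since the cocycle rule shifts [z] for the second factor. *)
have cost_ge0 x : semigroup_gen W x ->
    forall z : 'rV[R]_n, 0 <= engel_cost (graded_part x) z.
  elim=> {x} [_ [u + <-] z|x y _ IHx _ IHy z].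
    rewrite /mkset lE /A graded_part_V1 ?subvsP// => Au.
    exact: engel_cost_horizontal.
  by rewrite graded_part_bch3 engel_cost_bch3 addr_ge0.
(* The element [lie Y c] is sent to [- engelZ], of cost -2. It is itself a group commutator, as [c]
   lies in [V2] and the correction terms vanish. *)
pose c := lie X Y.
have V2c : c \in V2 by exact: (lie11 G).
have V3Yc : lie Y c \in V3 by exact: (lie12 G).
have cE : bch3 (bch3 Y c) (bch3 (- Y) (- c)) = lie Y c.
  rewrite bch3_commutator; last exact: (lie4_eq0 G).
  by rewrite !(lie_V3 G _ V3Yc) !scaler0 !addr0.
have : 0 <= engel_cost (graded_part (lie Y c)) 0.
  rewrite -cE; apply: (@lie_closure_min _ _ _ _ engel_cost_closed).
    by move=> x /cost_ge0; apply.
  by apply: sub; exact: commutator_in.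
rewrite /c !graded_part_lie (gX : _ = engelX) (gY : _ = engelY (Ordinal n_gt0)).
rewrite (lieC engelX) lieNr engel_lieYX engel_lieYT eqxx /engel_cost /=.
rewrite big1 => [|i _]; last by rewrite !mxE oppr0; ring.
by rewrite addr0 mulrN1 oppr_ge0 leNgt ltr0n.
Qed.

End EngelQuotientObstruction.

Theorem theorem1p2 (R : realType) (g : vectLieAlgType R) (s : nat)
    (V : nat -> {vspace g}) (strat : stratification s V) (s_le3 : (s <= 3)%N) :
  ~ semigenerated (V 1%N) <->
  exists n : nat, (1 <= n)%N /\ has_engel_quotient s V n.
Proof.
have [V2 [V3 [G homog]]] := stratification_grading3 strat s_le3.
split=> [nsg|[n [n_gt0 [I _ [h hbij hlie]]]]].
  have /existsNP[W /not_implyP[hW nW]] := nsg.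
  have [n [n_gt0 [I IE Iiso]]] := not_semigenerating_engel_quotient G hW nW.
  by exists n; split=> //; exists I; [exact: homog|exact: Iiso].
pose f0 x : engel R n := h (\pi_(lie_quot I)%qT x).
have f0_linear : linear f0.
  move=> a x y; rewrite /f0 quotD -linearP; congr (h (_ + _)).
  by rewrite -quot_scaleE.
pose f : {linear g -> engel R n} :=
  HB.pack f0 (GRing.isLinear.Build _ _ _ _ _ f0_linear).
apply: (@not_semigenerated_of_morphism _ _ _ _ _ G n f n_gt0) => [x y|e].
  by rewrite /f /= /f0 -hlie -quot_lieE.
have [k _ hK] := hbij; exists (repr (k e)).
by rewrite /f /= /f0 reprK hK.
Qed.
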